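(* Let $k$ be a field, let $G$ be a tree with vertex set $\{1,\dots,n\}$, and let $S=k[x_1,\ldots,x_n,y_1,\ldots,y_n]$. Then the edge binomials of $G$ form a $d$-sequence in $S$ if and only if the degree sequence of $G$ has one of the following forms: (i) $(1,1)$; (ii) $(m,2,\dots,1)$ or $(m,1,\dots,1)$, where $2\le m<n$; (iii) $(m,3,2,\dots,1)$ or $(m,3,1,\dots,1)$, where $3\le m<n$ and the vertex of degree $m$ and the vertex of degree $3$ (corresponding to the first two entries) are adjacent in $G$. Moreover, in these cases the binomial edge ideal $J_G$ is of linear type.
   Context: For an edge $\{i,j\}$ of a finite simple graph $G$ on $\{1,\dots,n\}$ with $i<j$, the edge binomial is $f_{ij}=x_iy_j-x_jy_i\in S$; the binomial edge ideal $J_G\subset S$ is the ideal generated by all edge binomials of $G$. A sequence $a_1,\ldots,a_r$ ($r\ge 1$) of elements of a commutative ring $S$ is a $d$-sequence if, with $a_0=0$: (1) $a_1,\dots,a_r$ is a minimal system of generators of the ideal $(a_1,\dots,a_r)$; and (2) $(a_0,\ldots,a_i):a_{i+1}a_j=(a_0,\ldots,a_i):a_j$ for all $0\le i\le r-1$ and all $j\ge i+1$. ''The edge binomials of $G$ form a $d$-sequence'' means that the edge binomials of all edges of $G$ can be ordered into a sequence which is a $d$-sequence. The degree sequence of a graph is the non-increasing sequence of its vertex degrees. The notation $(m,2,\dots,1)$ means: first entry $m$, followed by one or more entries equal to $2$, followed by entries equal to $1$; $(m,1,\dots,1)$ means first entry $m$ and all other entries $1$. Thus form (ii) says that the first entry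 is $m$ and all the other entries are in $\{1,2\}$. Likewise form (iii) says that the first entry is $m\ge 3$, the second is $3$, and all remaining entries are in $\{1,2\}$. An ideal $I\subset S$ is of linear type if the canonical surjection from the symmetric algebra of $I$ to the Rees algebra of $I$ is an isomorphism. *)

(* Defs.v *)
From HB Require Import structures.
From mathcomp Require Import all_boot all_algebra ring_quotient.
From mathcomp Require Import boolp.
From mathcomp Require Import finmap.
From mathcomp Require Import -(notations) monalg.
From mathcomp Require Import mpoly.

Set Implicit Arguments.
Unset Strict Implicit.
Unset Printing Implicit Defensive.

Import GRing.Theory.
Local Open Scope ring_scope.
Local Open Scope quotient_scope.

(** * Ideals *)

Section Ideals.
Variable S : comNzRingType.
Implicit Types (A : S -> Prop) (x : S).

Definition gen_ideal A : {pred S} := fun x =>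
  `[< exists n (c g : 'I_n -> S),
        (forall i, A (g i)) /\ x = \sum_(i < n) c i * g i >].

Lemma gen_idealP A x :
  reflect (exists n (c g : 'I_n -> S),
             (forall i, A (g i)) /\ x = \sum_(i < n) c i * g i)
          (x \in gen_ideal A).
Proof. exact: asboolP. Qed.

Lemma mem_gen_ideal A x : A x -> x \in gen_ideal A.
Proof.
move=> Ax; apply/gen_idealP; exists 1%N, (fun=> 1), (fun=> x).
by rewrite big_ord1 mul1r.
Qed.

Lemma gen_ideal0 A : 0 \in gen_ideal A.
Proof.
apply/gen_idealP; exists 0%N, (fun=> 0), (fun=> 0); split; first by case.
by rewrite big_ord0.
Qed.

Lemma gen_idealMD A a x y :
  x \in gen_ideal A -> y \in gen_ideal A -> a * x + y \in gen_ideal A.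
Proof.
move=> /gen_idealP[n [c [g [Ag ->]]]] /gen_idealP[m [d [h [Ah ->]]]].
pose pick (u : 'I_n -> S) (v : 'I_m -> S) (i : 'I_(n + m)) :=
  match fintype.split i with inl j => u j | inr j => v j end.
apply/gen_idealP; exists (n + m)%N, (pick (fun i => a * c i) d), (pick g h).
split=> [i|]; first by rewrite /pick; case: fintype.split.
rewrite big_split_ord /= mulr_sumr; congr (_ + _); apply: eq_bigr => i _.
  by rewrite /pick; case: splitP => j /= ij;
    [by rewrite (val_inj ij : i = j) mulrA | by have := ltn_ord i; rewrite ij ltnNge leq_addr].
rewrite /pick; case: splitP => j /= ij.
  by have := ltn_ord j; rewrite -ij ltnNge leq_addr.
by rewrite (val_inj (addnI ij) : i = j).
Qed.

Lemma gen_ideal_submod A : GRing.submod_closed (gen_ideal A : {pred S^o}).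
Proof.
by split=> [|a x y xA yA]; [exact: gen_ideal0 | exact: gen_idealMD].
Qed.

(* An ideal of S is a submodule of the regular module S^o. *)
Definition ideal_of A : submodClosed S^o :=
  HB.pack_for (submodClosed S^o) (gen_ideal A : S^o -> bool)
    (GRing.isSubmodClosed.Build S S^o (gen_ideal A) (gen_ideal_submod A)).

End Ideals.

(** * The symmetric algebra of a module *)

(* The polynomial ring S[X_u : u in M], one variable for each element of M. *)
Definition freeAlg (S : comNzRingType) (M : lmodType S) :=
  monalg.malg (monalg.cmonom M) S.
HB.instance Definition _ (S : comNzRingType) (M : lmodType S) :=
  GRing.ComAlgebra.on (freeAlg M).

(* The variable X_u.  Locked, as otherwise comparing two variables during
   unification unfolds the finitely supported functions encoding them. *)
HB.lock Definition freeX (S : comNzRingType) (M : lmodType S) (u : M) :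
  freeAlg M := monalg.mkmalgU (monalg.ucm u) 1.

Section SymmetricAlgebra.
Variables (S : comNzRingType) (M : lmodType S).
Local Notation freeAlg := (freeAlg M).

Definition sym_rel (r : freeAlg) : Prop :=
  exists (a : S) (u v : M), r = freeX (a *: u + v) - (a *: freeX u + freeX v).

Section Eval.
Variables (B : comAlgType S) (h : M -> B).

Definition mon_eval (m : monalg.cmonom M) : B :=
  \prod_(u <- finsupp m) h u ^+ m u.

Definition free_eval : freeAlg -> B := monalg.mmap (in_alg B) mon_eval.

Lemma mon_evalEw (d : {fset M}) (m : monalg.cmonom M) :
  (finsupp m `<=` d)%fset -> mon_eval m = \prod_(u <- d) h u ^+ m u.
Proof.
move=> le; rewrite /mon_eval (big_fset_incl _ le) // => u ud.
by rewrite memNfinsupp => /eqP ->; rewrite expr0.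
Qed.

Lemma mon_eval_morph : monalg.mmorphism mon_eval.
Proof.
split=> [m1 m2|]; last by rewrite /mon_eval monalg.mdom1 big_seq_fset0.
rewrite (mon_evalEw (d := finsupp (monalg.mul m1 m2))) //.
rewrite (@mon_evalEw (finsupp (monalg.mul m1 m2)) m1); last first.
  by rewrite monalg.mdomD fsubsetUl.
rewrite (@mon_evalEw (finsupp (monalg.mul m1 m2)) m2); last first.
  by rewrite monalg.mdomD fsubsetUr.
by rewrite -big_split /=; apply: eq_bigr => u _; rewrite monalg.cmM exprD.
Qed.

HB.instance Definition _ :=
  monalg.isMultiplicative.Build _ _ mon_eval mon_eval_morph.

HB.instance Definition _ := GRing.RMorphism.copy free_eval
  (monalg.mmap (in_alg B) mon_eval).

Lemma free_evalX u : free_eval (freeX u) = h u.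
Proof.
rewrite freeX.unlock /free_eval monalg.mmapU /= scale1r mul1r /mon_eval monalg.mdomU.
by rewrite big_seq_fset1 monalg.cmUU expr1.
Qed.

Lemma free_evalZ a p : free_eval (a *: p) = a *: free_eval p.
Proof. by rewrite /free_eval monalg.mmapZ /= mulr_algl. Qed.

Lemma free_evalM p q : free_eval (p * q) = free_eval p * free_eval q.
Proof. exact: rmorphM. Qed.

Lemma free_evalD p q : free_eval (p + q) = free_eval p + free_eval q.
Proof. exact: rmorphD. Qed.

Lemma free_evalB p q : free_eval (p - q) = free_eval p - free_eval q.
Proof. exact: rmorphB. Qed.

Lemma free_eval1 : free_eval 1 = 1.
Proof. exact: rmorph1. Qed.

End Eval.

Lemma free_eval_rel (B : comAlgType S) (f : {linear M -> B}) r :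
  r \in gen_ideal sym_rel -> free_eval f r = 0.
Proof.
move=> /gen_idealP[n [c [g [gP ->]]]]; rewrite (rmorph_sum (free_eval f)) big1 //= => i _.
have [a [u [v ->]]] := gP i.
by rewrite free_evalM free_evalB free_evalD free_evalZ !free_evalX linearP subrr
  mulr0.
Qed.

Lemma sym_rel_ideal : idealr_closed (gen_ideal sym_rel).
Proof.
split=> [||a p q]; [exact: gen_ideal0 | | exact: gen_idealMD].
apply/negP => /(free_eval_rel (\0 : {linear M -> S^o}))/eqP.
by rewrite free_eval1 oner_eq0.
Qed.

HB.instance Definition _ :=
  isIdealr.Build freeAlg (gen_ideal sym_rel) sym_rel_ideal.

Definition symAlg := {ideal_quot gen_ideal sym_rel}.
HB.instance Definition _ := GRing.ComNzRing.on symAlg.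

Definition sym_gen (u : M) : symAlg := \pi_symAlg (freeX u).

(* The S-algebra morphism symAlg -> B induced by a linear map f : M -> B;
   sym_liftE shows that it is independent of the choice of representative. *)
Definition sym_lift (B : comAlgType S) (f : {linear M -> B}) (w : symAlg) : B :=
  free_eval f (repr w).

Section Lift.
Variables (B : comAlgType S) (f : {linear M -> B}).

Lemma sym_liftE p : sym_lift f (\pi_symAlg p) = free_eval f p.
Proof.
apply/eqP; rewrite -subr_eq0 -free_evalB; apply/eqP/free_eval_rel.
by rewrite Quotient.idealrBE reprK.
Qed.

Lemma sym_lift_gen u : sym_lift f (sym_gen u) = f u.
Proof. by rewrite /sym_gen sym_liftE free_evalX. Qed.

Lemma sym_lift_zmod_morphism : zmod_morphism (sym_lift f).
Proof.
move=> u v; rewrite -[u]reprK -[v]reprK -[in LHS]rmorphB !sym_liftE.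
exact: free_evalB.
Qed.

Lemma sym_lift_monoid_morphism : monoid_morphism (sym_lift f).
Proof.
split=> [|u v]; first by rewrite -(rmorph1 \pi_symAlg) sym_liftE free_eval1.
rewrite -[u]reprK -[v]reprK -[in LHS]rmorphM !sym_liftE.
exact: free_evalM.
Qed.

HB.instance Definition _ :=
  GRing.isZmodMorphism.Build symAlg B (sym_lift f) sym_lift_zmod_morphism.
HB.instance Definition _ :=
  GRing.isMonoidMorphism.Build symAlg B (sym_lift f) sym_lift_monoid_morphism.

End Lift.

End SymmetricAlgebra.

(** * The Rees algebra of an ideal, and ideals of linear type *)

Section Rees.
Variables (S : comNzRingType) (I : submodClosed S^o).

Record ideal_type := IdealElt { ideal_val : S^o; _ : ideal_val \in I }.
HB.instance Definition _ := [isSub for ideal_val].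
HB.instance Definition _ := [Choice of ideal_type by <:].
HB.instance Definition _ := [SubChoice_isSubLmodule of ideal_type by <:].

(* The n-th power of I; for n = 0 it is generated by the empty product 1. *)
Definition ideal_pow n : {pred S} :=
  gen_ideal (fun y => exists g : 'I_n -> S,
                        (forall i, g i \in I) /\ y = \prod_(i < n) g i).

Lemma ideal_pow0 x : x \in ideal_pow 0.
Proof.
rewrite -[x]addr0 -[x]mulr1; apply: gen_idealMD (gen_ideal0 _).
apply: mem_gen_ideal; exists (fun=> 0); split; first by case.
by rewrite big_ord0.
Qed.

Lemma ideal_pow1 x : x \in I -> x \in ideal_pow 1.
Proof.
by move=> xI; apply: mem_gen_ideal; exists (fun=> x); rewrite big_ord1.
Qed.

Lemma ideal_powD n a b :
  a \in ideal_pow n -> b \in ideal_pow n -> a + b \in ideal_pow n.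
Proof. by move=> aI bI; rewrite -[a]mul1r gen_idealMD. Qed.

Lemma ideal_powMl n a b : b \in ideal_pow n -> a * b \in ideal_pow n.
Proof. by move=> bI; rewrite -[_ * _]addr0 gen_idealMD ?gen_ideal0. Qed.

Lemma ideal_pow_sum n (J : Type) (r : seq J) (P : pred J) (F : J -> S) :
  (forall j, P j -> F j \in ideal_pow n) ->
  \sum_(j <- r | P j) F j \in ideal_pow n.
Proof.
move=> FI; elim/big_rec: _ => [|j x Pj xI]; first exact: gen_ideal0.
by rewrite ideal_powD ?FI.
Qed.

Lemma ideal_powM m n a b :
  a \in ideal_pow m -> b \in ideal_pow n -> a * b \in ideal_pow (m + n).
Proof.
move=> /gen_idealP[p [c [g [gI ->]]]] /gen_idealP[q [d [h [hI ->]]]].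
rewrite mulr_suml; apply: ideal_pow_sum => i _.
rewrite mulr_sumr; apply: ideal_pow_sum => j _.
rewrite mulrACA; apply: ideal_powMl; apply: mem_gen_ideal.
have [u [uI ->]] := gI i; have [v [vI ->]] := hI j.
exists (fun k => match fintype.split k with inl k => u k | inr k => v k end).
split=> [k|]; first by case: fintype.split.
rewrite big_split_ord /=; congr (_ * _); apply: eq_bigr => k _.
  case: splitP => l /= kl; first by rewrite (val_inj kl : k = l).
  by have := ltn_ord k; rewrite kl ltnNge leq_addr.
case: splitP => l /= kl; last by rewrite (val_inj (addnI kl) : k = l).
by have := ltn_ord l; rewrite -kl ltnNge leq_addr.
Qed.

(* The Rees algebra is the subalgebra of S[t] (t is written 'X) of the
   polynomials whose coefficient of t^n is in I^n, for all n. *)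
Definition rees_pred : {pred {poly S}} := fun p =>
  `[< forall n, p`_n \in ideal_pow n >].

Lemma rees_predP (p : {poly S}) :
  reflect (forall n, p`_n \in ideal_pow n) (p \in rees_pred).
Proof. exact: asboolP. Qed.

Lemma rees_subalg : GRing.subalg_closed rees_pred.
Proof.
split=> [|a p q /rees_predP pI /rees_predP qI|p q /rees_predP pI /rees_predP qI];
  apply/rees_predP => n.
- by rewrite coef1; case: n => [|n]; [exact: ideal_pow0 | exact: gen_ideal0].
- by rewrite coefD coefZ; apply: gen_idealMD.
- rewrite coefM; apply: ideal_pow_sum => i _.
  by have := ideal_powM (pI i) (qI (n - i)%N); rewrite subnKC // -ltnS.
Qed.

HB.instance Definition _ :=
  GRing.isSubalgClosed.Build S {poly S} rees_pred rees_subalg.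

Record reesAlg := ReesElt { rees_val : {poly S}; _ : rees_val \in rees_pred }.
HB.instance Definition _ := [isSub for rees_val].
HB.instance Definition _ := [Choice of reesAlg by <:].
HB.instance Definition _ := [SubChoice_isSubComNzRing of reesAlg by <:].
HB.instance Definition _ := [SubZmodule_isSubLmodule of reesAlg by <:].
HB.instance Definition _ :=
  [SubNzRing_SubLmodule_isSubLalgebra of reesAlg by <:].
HB.instance Definition _ := [SubLalgebra_isSubAlgebra of reesAlg by <:].

Lemma rees_genP (a : ideal_type) :
  (ideal_val a : S) *: 'X \in rees_pred.
Proof.
apply/rees_predP => n; rewrite coefZ coefX.
case: eqVneq => [->|_]; last by rewrite mulr0; apply: gen_ideal0.
by rewrite mulr1; apply/ideal_pow1/(valP a).
Qed.

Definition rees_gen (a : ideal_type) : reesAlg := ReesElt (rees_genP a).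

Lemma rees_gen_linear : linear rees_gen.
Proof.
by move=> a u v; apply: val_inj; rewrite /= scalerDl scalerA.
Qed.

HB.instance Definition _ :=
  GRing.isLinear.Build S ideal_type reesAlg *:%R rees_gen rees_gen_linear.

(* The canonical surjection Sym(I) -> R(I), sending the class of a in I to
   a t. *)
Definition sym_to_rees : symAlg ideal_type -> reesAlg := sym_lift rees_gen.
HB.instance Definition _ := GRing.RMorphism.on sym_to_rees.

Definition linear_type : Prop := bijective sym_to_rees.

End Rees.

(** * d-sequences *)

Section DSequence.
Variable S : comNzRingType.
Implicit Types (a : seq S) (I : {pred S}).

Definition seq_ideal a : {pred S} := gen_ideal (fun y => y \in a).

Definition colon I (b : S) : {pred S} := fun x => x * b \in I.

(* No proper subsequence of a generates the same ideal. *)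
Definition minimal_generators a : Prop :=
  forall b, subseq b a -> seq_ideal b =i seq_ideal a -> b = a.

(* The usual condition (a_0, ..., a_i) : a_(i+1) a_j = (a_0, ..., a_i) : a_j
   for j >= i+1, where a_0 = 0, with the elements of a numbered from 0: a_(i+1)
   is a`_i, the j below is one less than the usual j, and (a_0, ..., a_i) is
   generated by the first i elements of a. *)
Definition d_sequence a : Prop :=
  [/\ (0 < size a)%N,
      minimal_generators a
    & forall i j, (i <= j < size a)%N ->
        colon (seq_ideal (take i a)) (a`_i * a`_j)
          =i colon (seq_ideal (take i a)) a`_j].

End DSequence.

(** * Trees and binomial edge ideals *)

(* A simple graph on the vertex set {0, ..., n-1} is a symmetric irreflexive
   relation on 'I_n. *)
Definition simple_graph n (e : rel 'I_n) : Prop :=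
  ssrbool.symmetric e /\ irreflexive e.

Definition is_tree n (e : rel 'I_n) : Prop :=
  [/\ (0 < n)%N,
      simple_graph e,
      forall u v, connect e u v
    & forall c : seq 'I_n, (2 < size c)%N -> ~~ ucycleb e c].

Definition degree n (e : rel 'I_n) (v : 'I_n) : nat := #|[set w | e v w]|.

Definition degree_sequence n (e : rel 'I_n) : seq nat :=
  sort geq [seq degree e v | v <- enum 'I_n].

Section BinomialEdgeIdeal.
Variables (k : fieldType) (n : nat).

(* Variables 0, ..., n-1 are the x_i, and variables n, ..., 2n-1 the y_i. *)
Definition xvar (i : 'I_n) : {mpoly k[n + n]} := 'X_(lshift n i).
Definition yvar (i : 'I_n) : {mpoly k[n + n]} := 'X_(rshift n i).

Definition edge_binomial (i j : 'I_n) : {mpoly k[n + n]} :=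
  xvar i * yvar j - xvar j * yvar i.

Variable e : rel 'I_n.

Definition edge_binomials : seq {mpoly k[n + n]} :=
  [seq edge_binomial ij.1 ij.2
     | ij <- enum [pred ij : 'I_n * 'I_n | (ij.1 < ij.2)%N && e ij.1 ij.2]].

Definition binomial_edge_ideal : submodClosed {mpoly k[n + n]}^o :=
  ideal_of (fun f => f \in edge_binomials).

Definition edge_binomials_form_d_sequence : Prop :=
  exists a, perm_eq a edge_binomials /\ d_sequence a.

End BinomialEdgeIdeal.

(** * The degree sequences of the classification *)

Section Forms.
Variables (n : nat) (e : rel 'I_n).

Definition form_i : Prop := degree_sequence e = [:: 1; 1]%N.

(* p = 0 gives (m,1,...,1), and p > 0 gives (m,2,...,1). *)
Definition form_ii : Prop :=
  exists m p q : nat,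
    (2 <= m < n)%N /\ degree_sequence e = m :: nseq p 2 ++ nseq q 1.

(* p = 0 gives (m,3,1,...,1), and p > 0 gives (m,3,2,...,1). *)
Definition form_iii : Prop :=
  exists m p q : nat,
    [/\ (3 <= m < n)%N,
        degree_sequence e = m :: 3 :: nseq p 2 ++ nseq q 1
      & exists u v, [/\ degree e u = m, degree e v = 3%N & e u v]].

End Forms.

(* Main.v *)
From HB Require Import structures.
Require Import Defs.
From mathcomp Require Import all_boot all_algebra ring_quotient.
From mathcomp Require Import boolp finmap.
From mathcomp Require Import -(notations) monalg.
From mathcomp Require Import mpoly ring zify.

(** Order the edges of a tree.  The edge binomials form a d-sequence in this
    order if and only if the order is good: every edge which comes third or
    later among the edges at some vertex p is followed by edges at p only.

    If the order is not good, say e = {p, u} comes after {p, w} and {p, w'} and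
    before an edge {a, b} not at p, then f_ww' f_pu lies in the ideal J of the
    edges before e by a Plücker relation, whereas f_ww' f_ab is not in J: it
    does not vanish at a point given by a suitable 2-colouring of the tree
    minus p, at which J vanishes.

    If the order is good, everything follows from one regularity statement: if
    the neighbourhoods of u and v are cliques of a graph H in which u and v are
    not connected, then f_uv is a nonzerodivisor modulo J_H.  It is proved with
    Ohtani's formula: J_H is the intersection of J_H' and (x_w, y_w) + J_(H - w),
    where H' is obtained from H by making the neighbourhood of w a clique.  This
    reduces to disjoint unions of cliques, for which J_H is the kernel of
    x_i -> x_i, y_i -> x_i y_(class of i).  As f_uv maps J_H'' into J_H, where
    H'' is H with the neighbourhoods of u and v made into cliques, this
    determines J_H : f_uv for all H.

    A good order exists if and only if at most two vertices have degree > 2 and,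
    in case there are two, they are adjacent and one of them has degree 3.

    An ideal generated by a d-sequence a_1, ..., a_r is of linear type because
    ((a_1, ..., a_i) : a_(i+1)) meets (a_1, ..., a_r) in (a_1, ..., a_i) only. *)

Set Implicit Arguments.
Unset Strict Implicit.
Unset Printing Implicit Defensive.

Import GRing.Theory.
Local Open Scope ring_scope.

(** * Ideals given by generators *)

Section GenIdeal.
Variable S : comNzRingType.
Implicit Types (A B : S -> Prop) (x y : S).

Lemma gen_ideal_ind A (P : S -> Prop) :
    P 0 -> (forall x y, P x -> P y -> P (x + y)) ->
    (forall c x, A x -> P (c * x)) ->
  forall x, x \in gen_ideal A -> P x.
Proof.
move=> P0 PD PA x /gen_idealP[m [c [g [gA ->]]]].
by elim/big_ind: _ => // i _; apply: PA.
Qed.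

Lemma gen_idealD A x y :
  x \in gen_ideal A -> y \in gen_ideal A -> x + y \in gen_ideal A.
Proof. by move=> xA yA; rewrite -[x]mul1r gen_idealMD. Qed.

Lemma gen_idealMl A c x : x \in gen_ideal A -> c * x \in gen_ideal A.
Proof. by move=> xA; rewrite -[_ * _]addr0 gen_idealMD ?gen_ideal0. Qed.

Lemma gen_idealMr A c x : x \in gen_ideal A -> x * c \in gen_ideal A.
Proof. by rewrite mulrC; apply: gen_idealMl. Qed.

Lemma gen_idealN A x : x \in gen_ideal A -> - x \in gen_ideal A.
Proof. by move=> xA; rewrite -mulN1r gen_idealMl. Qed.

Lemma gen_idealB A x y :
  x \in gen_ideal A -> y \in gen_ideal A -> x - y \in gen_ideal A.
Proof. by move=> xA yA; rewrite gen_idealD ?gen_idealN. Qed.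

Lemma gen_ideal_sum A (J : Type) (r : seq J) (P : pred J) (F : J -> S) :
  (forall j, P j -> F j \in gen_ideal A) ->
  \sum_(j <- r | P j) F j \in gen_ideal A.
Proof.
move=> FA; elim/big_rec: _ => [|j x Pj xA]; first exact: gen_ideal0.
by rewrite gen_idealD ?FA.
Qed.

Lemma gen_ideal_sub A B :
    (forall x, A x -> x \in gen_ideal B) ->
  forall x, x \in gen_ideal A -> x \in gen_ideal B.
Proof.
move=> AB; apply: gen_ideal_ind; first exact: gen_ideal0.
- by move=> x y; apply: gen_idealD.
- by move=> c x /AB xB; rewrite gen_idealMl.
Qed.

End GenIdeal.

Lemma mem_colon (S : comNzRingType) (I : {pred S}) b g :
  (g \in colon I b) = (g * b \in I).
Proof. by []. Qed.


(** * Ideals generated by d-sequences are of linear type *)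

Section DSequenceColon.
Variables (S : comNzRingType) (a : seq S).
Implicit Types (g h c x : S).

Lemma seq_ideal_takeS i g : (i < size a)%N ->
  g \in seq_ideal (take i.+1 a) ->
  exists h c, h \in seq_ideal (take i a) /\ g = h + c * a`_i.
Proof.
move=> ia; move: g; apply: gen_ideal_ind =>
  [|_ _ [h [c [hI ->]]] [h' [c' [h'I ->]]]|c x].
- by exists 0, 0; rewrite gen_ideal0 mul0r addr0.
- by exists (h + h'), (c + c'); split; [exact: gen_idealD|ring].
rewrite (take_nth 0 ia) mem_rcons inE => /predU1P[->|xi].
  by exists 0, c; rewrite gen_ideal0 add0r.
by exists (c * x), 0; split; [apply/gen_idealMl/mem_gen_ideal|rewrite mul0r addr0].
Qed.

Lemma seq_ideal_sub_take i j : (i <= j)%N ->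
  {subset seq_ideal (take i a) <= seq_ideal (take j a)}.
Proof.
move=> ij; apply: gen_ideal_sub => x xi; apply: mem_gen_ideal.
by move: xi; rewrite -(minn_idPl ij) take_min; apply: mem_take.
Qed.

Lemma seq_ideal_span j x : x \in seq_ideal (take j a) ->
  exists c : nat -> S, x = \sum_(i < j) c i * a`_i.
Proof.
move: x; apply: gen_ideal_ind => [|_ _ [c ->] [c' ->]|c x xj].
- by exists (fun=> 0); rewrite big1 // => i _; rewrite mul0r.
- exists (fun i => c i + c' i); rewrite -big_split; apply: eq_bigr => i _.
  by rewrite mulrDl.
have ltj : (index x (take j a) < j)%N.
  by apply: leq_trans (geq_minl j (size a)); rewrite -size_take_min index_mem.
exists (fun i => if i == index x (take j a) then c else 0).
rewrite (bigD1 (Ordinal ltj)) //= eqxx big1 => [|i]; last first.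
  by rewrite -val_eqE /= => /negPf ->; rewrite mul0r.
by rewrite addr0 -(nth_take 0 ltj) nth_index.
Qed.

Hypothesis a_dseq : d_sequence a.

Lemma d_sequence_colon_cap i g : (i < size a)%N ->
    g \in seq_ideal a -> g * a`_i \in seq_ideal (take i a) ->
  g \in seq_ideal (take i a).
Proof.
have [_ _ col] := a_dseq.
have [m] := ubnP (size a - i); elim: m i g => // m IH i g ltm ia ga gi.
have gi1 : g \in seq_ideal (take i.+1 a).
  have [ltS|geS] := ltnP i.+1 (size a); last by rewrite take_oversize.
  apply: IH => //.
    by rewrite -ltnS; apply: leq_trans ltm; rewrite ltnS ltn_sub2l.
  apply: (seq_ideal_sub_take (leqnSn i)).
  have iS : (i <= i.+1 < size a)%N by rewrite leqnSn.
  have := col i i.+1 iS g; rewrite !mem_colon => <-.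
  by rewrite mulrA gen_idealMr.
have [h [c [hI gE]]] := seq_ideal_takeS ia gi1.
rewrite gE gen_idealD //.
have ii : (i <= i < size a)%N by rewrite leqnn.
have := col i i ii c; rewrite !mem_colon => <-.
have -> : c * (a`_i * a`_i) = g * a`_i - h * a`_i by rewrite gE; ring.
by apply: gen_idealB => //; apply: gen_idealMr.
Qed.

End DSequenceColon.

(** * Scalars, generators and induction in a symmetric algebra *)

Section SymmetricAlgebraTheory.
Local Open Scope quotient_scope.
Variables (S : comNzRingType) (M : lmodType S).
Local Notation Sym := (symAlg M).

Definition sym_scal (c : S) : Sym := \pi_Sym (c%:A).

Lemma sym_scal0 : sym_scal 0 = 0.
Proof. by rewrite /sym_scal scale0r rmorph0. Qed.

Lemma sym_scalD : {morph sym_scal : c d / c + d}.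
Proof. by move=> c d; rewrite /sym_scal scalerDl rmorphD. Qed.

Lemma sym_scalM : {morph sym_scal : c d / c * d}.
Proof. by move=> c d; rewrite /sym_scal -rmorphM -scalerAl mul1r scalerA. Qed.

Lemma sym_scal1 : sym_scal 1 = 1.
Proof. by rewrite /sym_scal scale1r rmorph1. Qed.

Lemma sym_genP c (u v : M) :
  sym_gen (c *: u + v) = sym_scal c * sym_gen u + sym_gen v.
Proof.
rewrite /sym_gen /sym_scal -rmorphM -rmorphD -scalerAl mul1r.
apply/eqP; rewrite -Quotient.idealrBE; apply: mem_gen_ideal.
by exists c, u, v.
Qed.

Lemma sym_gen0 : sym_gen (0 : M) = 0.
Proof.
apply: (@addrI _ (sym_gen 0)); rewrite addr0.
by have := sym_genP 1 0 0; rewrite scaler0 addr0 sym_scal1 mul1r => <-.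
Qed.

(** A representative is a sum of monomials with coefficients, and a monomial of positive degree has
    a variable that can be split off; hence the induction on the degree. *)
Lemma sym_ind (P : Sym -> Prop) :
    (forall c, P (sym_scal c)) -> (forall w w', P w -> P w' -> P (w + w')) ->
    (forall u w, P w -> P (sym_gen u * w)) ->
  forall w, P w.
Proof.
move=> Pscal PD Pgen w; rewrite -[w]reprK; move: (repr w) => p {w}.
have Pmon (m : monalg.cmonom M) c : P (\pi_Sym (monalg.mkmalgU m c)).
  have [d] := ubnP (monalg.mdeg m); elim: d m => // d IH m ltd.
  have [m0|[u um]] := fset_0Vmem (finsupp m).
    have -> : monalg.mkmalgU m c = c%:A :> freeAlg M.
      have -> : m = monalg.one.
        apply/eqP/monalg.cmP => v; rewrite monalg.cm1; apply/eqP.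
        by rewrite monalg.cmE_eq0 m0 in_fset0.
      by rewrite -[RHS]monalg.mul_malgC mulr1.
    exact: Pscal.
  pose m' := monalg.divcm m (monalg.ucm u).
  have mE : m = monalg.mul (monalg.ucm u) m'.
    apply/eqP/monalg.cmP => v; rewrite monalg.cmM monalg.divcmE monalg.cmU.
    by rewrite subnKC //; case: eqP => // <-; rewrite lt0n monalg.cmE_neq0.
  have -> : monalg.mkmalgU m c = freeX u * monalg.mkmalgU m' c :> freeAlg M.
    by rewrite freeX.unlock monalg.malgM_def monalg.fgmulUU mul1r -mE.
  rewrite rmorphM; apply: Pgen; apply: IH.
  by rewrite -ltnS; apply: leq_trans ltd; rewrite mE monalg.mdegM monalg.mdegU.
rewrite [p]monalg.monalgE (raddf_sum \pi_Sym).
apply: (big_ind P) => [||m _]; [|exact: PD|exact: Pmon].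
by have := Pscal 0; rewrite sym_scal0.
Qed.

Lemma sym_lift_scal (B : comAlgType S) (f : {linear M -> B}) c :
  sym_lift f (sym_scal c) = c%:A.
Proof. by rewrite /sym_scal sym_liftE free_evalZ free_eval1. Qed.

End SymmetricAlgebraTheory.

(** * Bijectivity of the map from the symmetric algebra to the Rees algebra *)

Section LinearType.
Variables (S : comNzRingType) (I : submodClosed S^o) (a : seq S).
Hypothesis I_a : forall x : S, (x \in I) = (x \in seq_ideal a).
Hypothesis a_dseq : d_sequence a.
Local Notation M := (ideal_type I).
Local Notation Sym := (symAlg M).
Local Notation r := (size a).
Implicit Types (w : Sym) (c : S) (u : M).

Lemma nth_dseq_mem i : (a`_i : S^o) \in I.
Proof.
have [ir|ir] := ltnP i r; last by rewrite nth_default // rpred0.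
by rewrite (I_a a`_i); apply/mem_gen_ideal/mem_nth.
Qed.

Definition ideal_gen i : M := IdealElt (nth_dseq_mem i).
Local Notation G i := (sym_gen (ideal_gen i)).

Lemma sym_gen_comb j (c : nat -> S) :
  sym_gen (\sum_(i < j) c i *: ideal_gen i) = \sum_(i < j) G i * sym_scal M (c i).
Proof.
elim: j => [|j IH].
  by rewrite !big_ord0 sym_gen0.
by rewrite !big_ord_recr /= addrC sym_genP IH addrC [G _ * _]mulrC.
Qed.

Lemma ideal_comb (u : M) j : val u \in seq_ideal (take j a) ->
  exists c : nat -> S, u = \sum_(i < j) c i *: ideal_gen i.
Proof.
move=> /seq_ideal_span[c uE]; exists c; apply: val_inj.
rewrite [LHS]uE raddf_sum; apply: eq_bigr => i _.
by [].
Qed.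

(** The component of degree [d] of Sym(I), written with the generators [G i] alone. The recursive
    form lets the induction on [d] in [sym_deg_eval_mem] apply directly to the coefficients
    [v i]. *)
Fixpoint sym_deg d : Sym -> Prop :=
  if d is d'.+1 then fun w => exists v : nat -> Sym,
    (forall i, sym_deg d' (v i)) /\ w = \sum_(i < r) G i * v i
  else fun w => exists c, w = sym_scal M c.

Lemma sym_deg0 d : sym_deg d 0.
Proof.
elim: d => [|d IH]; first by exists 0; rewrite sym_scal0.
by exists (fun=> 0); split=> //; rewrite big1 // => i _; rewrite mulr0.
Qed.

Lemma sym_degD d w w' : sym_deg d w -> sym_deg d w' -> sym_deg d (w + w').
Proof.
elim: d w w' => [|d IH] w w' /=.
  by move=> [c ->] [c' ->]; exists (c + c'); rewrite sym_scalD.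
move=> [v [vh ->]] [v' [v'h ->]]; exists (fun i => v i + v' i); split.
  by move=> i; apply: IH.
by rewrite -big_split; apply: eq_bigr => i _; rewrite mulrDr.
Qed.

Lemma sym_degZ d c w : sym_deg d w -> sym_deg d (sym_scal M c * w).
Proof.
elim: d w => [|d IH] w /=; first by move=> [c' ->]; exists (c * c'); rewrite sym_scalM.
move=> [v [vh ->]]; exists (fun i => sym_scal M c * v i); split=> [i|]; first exact: IH.
by rewrite mulr_sumr; apply: eq_bigr => i _; rewrite mulrCA.
Qed.

Lemma sym_deg_gen d u w : sym_deg d w -> sym_deg d.+1 (sym_gen u * w).
Proof.
move=> wh; have [|c ->] := @ideal_comb u r.
  by rewrite take_size -I_a; apply: valP.
exists (fun i => sym_scal M (c i) * w); split=> [i|]; first exact: sym_degZ.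
by rewrite sym_gen_comb mulr_suml; apply: eq_bigr => i _; rewrite mulrA.
Qed.

(** Only existence of the decomposition is claimed here; the components are separated later by the
    powers of t in the Rees algebra. *)
Lemma sym_degP w : exists N (v : nat -> Sym),
  (forall d, sym_deg d (v d)) /\ w = \sum_(d < N) v d.
Proof.
elim/sym_ind: w => [c|_ _ [N [v [vh ->]]] [N' [v' [v'h ->]]]|u _ [N [v [vh ->]]]].
- exists 1%N, (fun d => if d is 0%N then sym_scal M c else 0).
  by split=> [[|d]|]; [exists c|exact: sym_deg0|rewrite big_ord1].
- exists (maxn N N'), (fun d => (if (d < N)%N then v d else 0)
                              + (if (d < N')%N then v' d else 0)).
  split=> [d|].
    by apply: sym_degD; case: ifP => _ //; apply: sym_deg0.
  rewrite big_split /= -!big_mkcond /=.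
  rewrite (big_ord_widen _ v (leq_maxl N N')).
  by rewrite (big_ord_widen _ v' (leq_maxr N N')).
- exists N.+1, (fun d => if d is d'.+1 then sym_gen u * v d' else 0).
  split=> [[|d]|]; [exact: sym_deg0|exact: sym_deg_gen|].
  by rewrite big_ord_recl add0r mulr_sumr.
Qed.

(** This is the map to the Rees algebra followed by t -> 1. On degree [d] it gives the coefficient
    of t^d, so the Rees map is injective once [sym_eval] is injective in each degree. *)
Definition sym_eval : Sym -> S^o := sym_lift (val : {linear M -> S^o}).
HB.instance Definition _ := GRing.RMorphism.on sym_eval.

Lemma sym_eval_scal c : sym_eval (sym_scal M c) = c.
Proof. by rewrite /sym_eval sym_lift_scal; apply: mulr1. Qed.

Lemma sym_eval_gen i : sym_eval (G i) = a`_i.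
Proof. exact: sym_lift_gen. Qed.

Lemma sym_eval_comb j (v : nat -> Sym) :
  sym_eval (\sum_(i < j) G i * v i) = \sum_(i < j) a`_i * sym_eval (v i).
Proof.
rewrite rmorph_sum; apply: eq_bigr => i _.
by rewrite rmorphM /= sym_eval_gen.
Qed.

Lemma comb_mem_seq_ideal j (c : nat -> S) :
  \sum_(i < j) a`_i * c i \in seq_ideal (take j a).
Proof.
apply: gen_ideal_sum => i _; apply: gen_idealMr.
have [ir|ir] := ltnP i r; last by rewrite nth_default ?gen_ideal0.
apply: mem_gen_ideal; rewrite -(nth_take 0 (ltn_ord i)) mem_nth //.
by rewrite size_take_min leq_min ltn_ord.
Qed.

(* Huneke's argument: by induction on d, then on r - j. Write w = h + G_j g
   with h in (G_0, ..., G_(j-1)); then sym_eval g is in I and is multiplied by a_j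
   into (a_0, ..., a_(j-1)), hence lies in the latter ideal. *)
Lemma sym_deg_eval_mem d j w : (j <= r)%N -> sym_deg d.+1 w ->
    sym_eval w \in seq_ideal (take j a) ->
  exists v : nat -> Sym,
    (forall i, sym_deg d (v i)) /\ w = \sum_(i < j) G i * v i.
Proof.
elim: d j w => [|d IHd] j w jr wh wj.
  have [v [vh wE]] := wh; have {vh}[c vE] := choice vh.
  have {wE}wE : w = sym_gen (\sum_(i < r) c i *: ideal_gen i).
    by rewrite sym_gen_comb wE; apply: eq_bigr => i _; rewrite vE.
  have [|b bE] := @ideal_comb (\sum_(i < r) c i *: ideal_gen i) j.
    by move: wj; rewrite wE /sym_eval sym_lift_gen.
  exists (fun i => sym_scal M (b i)); split=> [i|]; first by exists (b i).
  by rewrite wE bE sym_gen_comb.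
have [m] := ubnP (r - j); elim: m j jr wj => // m IHm j jr wj ltm.
have [rj|ltjr] := leqP r j.
  by have -> : j = r by apply/eqP; rewrite eqn_leq jr rj.
have [|||v [vh wE]] := IHm j.+1; rewrite ?ltjr //.
- exact: (seq_ideal_sub_take (leqnSn j)).
- by rewrite -ltnS; apply: leq_trans ltm; rewrite ltnS ltn_sub2l.
rewrite big_ord_recr /= in wE.
have gI : sym_eval (v j) \in seq_ideal a.
  have [v' [_ ->]] := vh j; rewrite sym_eval_comb -[X in seq_ideal X]take_size.
  exact: (comb_mem_seq_ideal r (fun i => sym_eval (v' i))).
have gj : sym_eval (v j) \in seq_ideal (take j a).
  apply: d_sequence_colon_cap => //.
  have -> : sym_eval (v j) * a`_j
      = sym_eval w - \sum_(i < j) a`_i * sym_eval (v i).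
    by rewrite wE rmorphD rmorphM /= sym_eval_comb sym_eval_gen addrC addKr mulrC.
  by apply: gen_idealB => //;
    exact: (comb_mem_seq_ideal j (fun i => sym_eval (v i))).
have [g [gh gE]] := IHd j (v j) jr (vh j) gj.
exists (fun i => v i + G j * g i); split=> [i|].
  by apply: sym_degD => //; apply: sym_deg_gen.
rewrite wE gE mulr_sumr -big_split; apply: eq_bigr => i _.
by rewrite mulrDr mulrCA.
Qed.

(** In positive degree this is [sym_deg_eval_mem] for [j = 0], where the combination of generators
    is an empty sum. *)
Lemma sym_deg_eval_inj d w : sym_deg d w -> sym_eval w = 0 -> w = 0.
Proof.
case: d => [|d] wh w0.
  by case: wh w0 => c ->; rewrite sym_eval_scal => ->; rewrite sym_scal0.
have [//||v [_ ->]] := @sym_deg_eval_mem d 0 w _ wh; last by rewrite big_ord0.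
by rewrite w0 gen_ideal0.
Qed.

Definition sym_rees : Sym -> {poly S} :=
  (val : reesAlg I -> {poly S}) \o @sym_to_rees S I.
HB.instance Definition _ := GRing.RMorphism.on sym_rees.

Lemma sym_reesM : {morph sym_rees : w w' / w * w'}.
Proof. exact: rmorphM. Qed.

Lemma sym_rees_sum N (v : nat -> Sym) :
  sym_rees (\sum_(d < N) v d) = \sum_(d < N) sym_rees (v d).
Proof. exact: rmorph_sum. Qed.

Lemma sym_rees_scal c : sym_rees (sym_scal M c) = c%:P.
Proof. by rewrite /sym_rees /= /sym_to_rees sym_lift_scal -alg_polyC. Qed.

Lemma sym_rees_gen u : sym_rees (sym_gen u) = (val u : S) *: 'X.
Proof. by rewrite /sym_rees /= /sym_to_rees sym_lift_gen. Qed.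

Lemma sym_rees_deg d w : sym_deg d w -> sym_rees w = (sym_eval w : S) *: 'X^d.
Proof.
elim: d w => [|d IH] w.
  by move=> [c ->]; rewrite sym_eval_scal sym_rees_scal expr0 alg_polyC.
move=> [v [vh ->]]; rewrite sym_eval_comb (sym_rees_sum _ (fun i => G i * v i)).
rewrite scaler_suml.
apply: eq_bigr => i _; rewrite sym_reesM (IH _ (vh i)) sym_rees_gen /=.
by rewrite exprS -scalerAr -scalerAl scalerA mulrC.
Qed.

Lemma sym_rees_eq0 w : sym_rees w = 0 -> w = 0.
Proof.
move=> w0; have [N [v [vh wE]]] := sym_degP w.
rewrite wE big1 // => d _; apply: (sym_deg_eval_inj (vh d)).
have := congr1 (fun p : {poly S} => p`_d) w0.
rewrite wE sym_rees_sum coef_sum coef0 (bigD1 d) //= (sym_rees_deg (vh d)).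
rewrite coefZ coefXn eqxx mulr1 big1 ?addr0 // => i.
rewrite -val_eqE /= eq_sym => /negPf id.
by rewrite (sym_rees_deg (vh i)) coefZ coefXn id mulr0.
Qed.

Lemma sym_rees_inj : injective sym_rees.
Proof. exact: raddf_inj sym_rees_eq0. Qed.

Lemma sym_rees_surj (p : reesAlg I) : exists w, sym_rees w = val p.
Proof.
have mono d x : x \in ideal_pow I d -> exists w, sym_rees w = x *: 'X^d.
  move: x; apply: gen_ideal_ind => [|x y [w wE] [w' w'E]|c _ [g [gI ->]]].
  - by exists 0; rewrite rmorph0 scale0r.
  - by exists (w + w'); rewrite rmorphD /= wE w'E scalerDl.
  exists (sym_scal M c * \prod_(i < d) sym_gen (IdealElt (gI i) : M)).
  rewrite sym_reesM (rmorph_prod sym_rees) sym_rees_scal mul_polyC -scalerA; congr (_ *: _).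
  rewrite (eq_bigr _ (fun i _ => sym_rees_gen (IdealElt (gI i)))) /=.
  by rewrite scaler_prod prodr_const card_ord.
have /rees_predP pI := valP p.
have [v vE] := choice (fun d => mono d _ (pI d)).
exists (\sum_(d < size (val p)) v d); rewrite sym_rees_sum.
rewrite -[RHS]coefK poly_def; apply: eq_bigr => d _; exact: vE.
Qed.

Lemma d_sequence_linear_type : linear_type I.
Proof.
have [g gK] := choice sym_rees_surj.
exists g => [w|p]; first by apply: sym_rees_inj; rewrite gK.
by apply: val_inj; apply: gK.
Qed.

End LinearType.

(** * Edge binomials, completing and deleting a vertex *)

Section PolynomialsInXY.
Variables (k : fieldType) (n : nat).
Local Notation S := {mpoly k[n + n]}.
Local Notation x := (xvar k).
Local Notation y := (yvar k).
Local Notation f := (edge_binomial k).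
Implicit Types (i j a b : 'I_n) (p g : S).

Lemma xypoly_ind (P : S -> Prop) :
    (forall c, P c%:MP) -> (forall i, P (x i)) -> (forall i, P (y i)) ->
    (forall p q, P p -> P q -> P (p + q)) ->
    (forall p q, P p -> P q -> P (p * q)) ->
  forall p, P p.
Proof.
move=> PC Px Py PD PM; elim/mpolyind => [|c m p _ _ Pp].
  by rewrite -mpolyC0.
apply: (PD) => //; rewrite -mul_mpolyC; apply: (PM) => //.
rewrite mpolyXE_id.
apply: (big_ind P) => [|p1 p2|i _]; first by rewrite -mpolyC1; apply: (PC).
  exact: PM.
elim: (m i) => [|d IH]; first by rewrite expr0 -mpolyC1; apply: (PC).
rewrite exprS; apply: (PM) => //.
by rewrite -(fintype.splitK i); case: (fintype.split i) => j; [exact: Px|exact: Py].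
Qed.

Section XYEval.
Variables (D : comNzRingType) (h : {rmorphism k -> D}) (X Y : 'I_n -> D).

Let XY (i : 'I_(n + n)) :=
  match fintype.split i with inl j => X j | inr j => Y j end.
Definition xy_eval : S -> D := mmap h XY.
HB.instance Definition _ := GRing.RMorphism.copy xy_eval (mmap h XY).

Lemma xy_evalC c : xy_eval c%:MP = h c.
Proof. exact: mmapC. Qed.

Lemma xy_eval_x i : xy_eval (x i) = X i.
Proof.
rewrite /xy_eval /xvar mmapX mmap1U /XY.
by rewrite -[lshift n i]/(fintype.unsplit (inl i)) fintype.unsplitK.
Qed.

Lemma xy_eval_y i : xy_eval (y i) = Y i.
Proof.
rewrite /xy_eval /yvar mmapX mmap1U /XY.
by rewrite -[rshift n i]/(fintype.unsplit (inr i)) fintype.unsplitK.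
Qed.

Lemma xy_eval_f i j : xy_eval (f i j) = X i * Y j - X j * Y i.
Proof. by rewrite /edge_binomial rmorphB !rmorphM /= !(xy_eval_x, xy_eval_y). Qed.

End XYEval.

Lemma edge_binomialC i j : f j i = - f i j.
Proof. by rewrite /edge_binomial opprB. Qed.

Lemma edge_binomial_diag i : f i i = 0.
Proof. by rewrite /edge_binomial subrr. Qed.

(* Plücker: the 2-minors of a 2 x 3 and of a 2 x 4 matrix. *)
Lemma xvar_edge_binomial i j a : x a * f i j = x i * f a j - x j * f a i.
Proof. by rewrite /edge_binomial; ring. Qed.

Lemma yvar_edge_binomial i j a : y a * f i j = y i * f a j - y j * f a i.
Proof. by rewrite /edge_binomial; ring. Qed.

Lemma edge_binomial_plucker i j a b :
  f a b * f i j = f b j * f a i - f b i * f a j.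
Proof. by rewrite /edge_binomial; ring. Qed.

(* The binomial edge ideal of the graph h, plus the variables indexed by T;
   h is meant to be reflexive, which is harmless as f i i = 0. *)
Definition cut_gen (h : rel 'I_n) (T : {set 'I_n}) : S -> Prop := fun g =>
  (exists a b, h a b /\ g = f a b) \/
  (exists t, t \in T /\ (g = x t \/ g = y t)).
Definition cut_ideal h T : {pred S} := gen_ideal (cut_gen h T).

Lemma cut_ideal_edge (h : rel 'I_n) T a b : h a b -> f a b \in cut_ideal h T.
Proof. by move=> hab; apply: mem_gen_ideal; left; exists a, b. Qed.

Lemma cut_ideal_x (h : rel 'I_n) (T : {set 'I_n}) t :
  t \in T -> x t \in cut_ideal h T.
Proof. by move=> tT; apply: mem_gen_ideal; right; exists t; split; [|left]. Qed.

Lemma cut_ideal_y (h : rel 'I_n) (T : {set 'I_n}) t :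
  t \in T -> y t \in cut_ideal h T.
Proof. by move=> tT; apply: mem_gen_ideal; right; exists t; split; [|right]. Qed.

Lemma cut_ideal_sub (h h' : rel 'I_n) (T : {set 'I_n}) g :
  subrel h h' -> g \in cut_ideal h T -> g \in cut_ideal h' T.
Proof.
move=> hh' ghT; apply: gen_ideal_sub ghT => _ [[a [b [hab ->]]]|[t [tT [->|->]]]].
- by rewrite cut_ideal_edge ?hh'.
- by rewrite cut_ideal_x.
- by rewrite cut_ideal_y.
Qed.

(** The polynomials [p] with this property are closed under products, because
    [f1 (p * q) - f2 (p * q)] is [f1 p * (f1 q - f2 q) + f2 q * (f1 p - f2 p)]; so checking the
    variables suffices. *)
Lemma eq_mod_ideal (A : S -> Prop) (f1 f2 : {rmorphism S -> S}) g :
    (forall c, f1 c%:MP = f2 c%:MP) ->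
    (forall i, (f1 (x i) - f2 (x i)) * g \in gen_ideal A) ->
    (forall i, (f1 (y i) - f2 (y i)) * g \in gen_ideal A) ->
  forall p, (f1 p - f2 p) * g \in gen_ideal A.
Proof.
move=> eqC eqx eqy; elim/xypoly_ind => // [c|p q pA qA|p q pA qA].
- by rewrite eqC subrr mul0r gen_ideal0.
- rewrite !rmorphD.
  have -> : (f1 p + f1 q - (f2 p + f2 q)) * g
    = (f1 p - f2 p) * g + (f1 q - f2 q) * g by ring.
  by apply: gen_idealD; [exact: pA|exact: qA].
- rewrite !rmorphM.
  have -> : (f1 p * f1 q - f2 p * f2 q) * g
    = f1 p * ((f1 q - f2 q) * g) + f2 q * ((f1 p - f2 p) * g) by ring.
  by apply: gen_idealD; apply: gen_idealMl; [exact: qA|exact: pA].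
Qed.

End PolynomialsInXY.

Section CutIdeals.
Variables (k : fieldType) (n : nat).
Local Notation S := {mpoly k[n + n]}.
Local Notation x := (xvar k).
Local Notation y := (yvar k).
Local Notation f := (edge_binomial k).
Local Notation cut_ideal := (@cut_ideal k n).
Implicit Types (i j a b : 'I_n) (p g : S) (h : rel 'I_n) (T : {set 'I_n}).

Definition kill T : S -> S :=
  xy_eval (mpolyC (n + n) (R := k)) (fun i => if i \in T then 0 else x i)
          (fun i => if i \in T then 0 else y i).
HB.instance Definition _ T := GRing.RMorphism.on (kill T).

Lemma kill0 T : kill T 0 = 0. Proof. exact: rmorph0. Qed.

Lemma killD T : {morph kill T : p q / p + q}. Proof. exact: rmorphD. Qed.

Lemma killM T : {morph kill T : p q / p * q}. Proof. exact: rmorphM. Qed.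

Lemma killC T c : kill T c%:MP = c%:MP.
Proof. exact: xy_evalC. Qed.

Lemma kill_x T i : kill T (x i) = if i \in T then 0 else x i.
Proof. exact: xy_eval_x. Qed.

Lemma kill_y T i : kill T (y i) = if i \in T then 0 else y i.
Proof. exact: xy_eval_y. Qed.

Lemma kill_f T a b :
  kill T (f a b) = if (a \in T) || (b \in T) then 0 else f a b.
Proof.
rewrite /kill xy_eval_f /edge_binomial.
by do 2!case: ifP => //= _; rewrite ?(mul0r, mulr0, subrr).
Qed.

Lemma sub_kill_mul T (A : S -> Prop) g p :
    (forall t, t \in T -> x t * g \in gen_ideal A /\ y t * g \in gen_ideal A) ->
  (p - kill T p) * g \in gen_ideal A.
Proof.
move=> gA; apply: (@eq_mod_ideal k n A idfun (kill T)) => [c|i|i] /=.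
- by rewrite killC.
- rewrite kill_x; case: ifP => [/gA[]|]; first by rewrite subr0.
  by rewrite subrr mul0r gen_ideal0.
- rewrite kill_y; case: ifP => [/gA[]|]; first by rewrite subr0.
  by rewrite subrr mul0r gen_ideal0.
Qed.

Definition complete_at h v : rel 'I_n := fun a b => h a b || (h v a && h v b).
(** The vertex [v] stays as an isolated point, and the diagonal keeps the relation reflexive. In the
    ideals, deletion is completed by adding [v] to the set [T] of variables. *)
Definition delete h v : rel 'I_n :=
  fun a b => (a == b) || [&& h a b, a != v & b != v].

Lemma cut_ideal_complete_mul h T v a b : h v a -> h v b ->
  x v * f a b \in cut_ideal h T /\ y v * f a b \in cut_ideal h T.
Proof.
move=> va vb; rewrite xvar_edge_binomial yvar_edge_binomial.
by split; rewrite gen_idealB ?gen_idealMl ?cut_ideal_edge.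
Qed.

(* Ohtani's lemma: a new generator f a b of J(complete_at h v) is fixed by
   [kill [set v]] while (x v, y v) * f a b lies in J(h), so that
   g - kill [set v] g is in J(h), for all g in J(complete_at h v). *)
Lemma cut_ideal_complete_delete h T v g : ssrbool.symmetric h ->
    g \in cut_ideal (complete_at h v) T ->
    g \in cut_ideal (delete h v) (v |: T) ->
  g \in cut_ideal h T.
Proof.
move=> hC gc gd; rewrite -[g](subrK (kill [set v] g)).
apply: gen_idealD.
  move: g gc {gd}; apply: gen_ideal_ind =>
  [|p q pI qI|c z [[a [b [hab ->]]]|[t [tT E]]]].
  - by rewrite kill0 subrr gen_ideal0.
  - have -> : p + q - kill [set v] (p + q)
        = (p - kill [set v] p) + (q - kill [set v] q) by rewrite killD; ring.
    exact: gen_idealD pI qI.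
  - have [ab|nab] := boolP (h a b).
      rewrite killM kill_f gen_idealB ?gen_idealMl ?cut_ideal_edge //.
      by case: ifP => _; rewrite ?gen_ideal0 ?cut_ideal_edge.
    case/orP: hab => [/negPn|/andP[va vb]]; first by rewrite nab.
    rewrite killM kill_f !inE.
    have [av|_] := eqVneq a v; first by rewrite av vb in nab.
    have [bv|_] := eqVneq b v; first by rewrite bv hC va in nab.
    rewrite -mulrBl; apply: sub_kill_mul => t; rewrite inE => /eqP ->.
    exact: cut_ideal_complete_mul.
  - rewrite killM gen_idealB ?gen_idealMl //.
      by case: E => ->; rewrite (cut_ideal_x, cut_ideal_y).
    by case: E => ->; rewrite (kill_x, kill_y); case: ifP => _;
      rewrite ?gen_ideal0 ?cut_ideal_x ?cut_ideal_y.
(* It remains to see that [kill [set v] g] is in J(h): the substitution sends the variables of [v]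
   to 0, and every other generator to 0 or to itself. *)
move: g gd {gc}; apply: gen_ideal_ind =>
  [|p q pI qI|c z [[a [b [hab ->]]]|[t [tT E]]]].
- by rewrite kill0 gen_ideal0.
- by rewrite killD gen_idealD.
- rewrite killM gen_idealMl // kill_f; case: ifP => _; rewrite ?gen_ideal0 //.
  case/orP: hab => [/eqP ->|/and3P[hab _ _]]; last exact: cut_ideal_edge.
  by rewrite edge_binomial_diag gen_ideal0.
- rewrite killM gen_idealMl //; move: tT; rewrite in_setU1.
  by case: E => ->; rewrite (kill_x, kill_y) inE; case: eqP => //= _ tT;
    rewrite ?gen_ideal0 ?cut_ideal_x ?cut_ideal_y.
Qed.

(** * Disjoint unions of cliques as kernels of monomial maps *)

Section CliqueUnion.
Variables (h : rel 'I_n) (c : 'I_n -> 'I_n).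
Hypothesis hc : forall i j, h i j = (c i == c j).

Definition clique_param : S -> S :=
  xy_eval (mpolyC (n + n) (R := k)) (fun i => x i) (fun i => x i * y (c i)).
HB.instance Definition _ := GRing.RMorphism.on clique_param.

Implicit Types m : 'X_{1..n + n}.

(** The action of [clique_param] on exponents. It records the total degree in x_i and y_i for each
    vertex i, and the degree in the y's for each clique. *)
Definition clique_exp m : 'X_{1..n + n} :=
  (\sum_i (U_(lshift n i) *+ m (lshift n i)) +
   \sum_i ((U_(lshift n i) + U_(rshift n (c i))) *+ m (rshift n i)))%MM.

Lemma clique_param_mono m : clique_param 'X_[m] = 'X_[clique_exp m].
Proof.
rewrite /clique_param /xy_eval mmapX /mmap1 big_split_ord /=.
rewrite /clique_exp mpolyXD -!mprodXnE.
congr (_ * _); apply: eq_bigr => i _.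
  by rewrite -[lshift n i in LHS]/(fintype.unsplit (inl i)) fintype.unsplitK.
rewrite -[rshift n i in LHS]/(fintype.unsplit (inr i)) fintype.unsplitK.
by rewrite mpolyXD.
Qed.

Lemma clique_exp_l m j :
  clique_exp m (lshift n j) = (m (lshift n j) + m (rshift n j))%N.
Proof.
rewrite /clique_exp mnmDE !mnm_sumE (bigD1 j) //= big1 => [|i /negPf ij].
  rewrite (bigD1 j) //= big1 => [|i /negPf ij].
    by rewrite !mulmnE mnmDE !mnm1E !eqxx eq_rlshift !addn0 !mul1n.
  by rewrite mulmnE mnmDE !mnm1E eq_rlshift eq_lshift ij.
by rewrite mulmnE !mnm1E eq_lshift ij.
Qed.

Lemma clique_exp_r m j :
  clique_exp m (rshift n j) = (\sum_(i | c i == j) m (rshift n i))%N.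
Proof.
rewrite /clique_exp mnmDE !mnm_sumE big1 => [|i _]; last first.
  by rewrite mulmnE mnm1E eq_lrshift.
rewrite [RHS]big_mkcond; apply: eq_bigr => i _.
rewrite mulmnE mnmDE !mnm1E eq_lrshift eq_rshift.
by case: eqP; rewrite ?mul1n.
Qed.

(* Two monomials with the same image differ by swaps x i * y j -> x j * y i
   inside the cliques; induction on the number of swaps needed. *)
Lemma clique_mono_congr T m m' : clique_exp m = clique_exp m' ->
  'X_[m] - 'X_[m'] \in cut_ideal h T.
Proof.
have [d] := ubnP (\sum_i (m (rshift n i) - m' (rshift n i))).
elim: d m => // d IH m ltd E.
have El j := congr1 (fun q : 'X_{1..n + n} => q (lshift n j)) E.
have Er j := congr1 (fun q : 'X_{1..n + n} => q (rshift n j)) E.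
have [/forallP le|] := boolP [forall i, m (rshift n i) <= m' (rshift n i)]%N.
  suff -> : m = m' by rewrite subrr gen_ideal0.
  have eqr i : m (rshift n i) = m' (rshift n i).
    have := Er (c i); rewrite !clique_exp_r => Ei.
    have leif := leqif_sum (P := fun j => c j == c i)
      (fun j _ => leqif_geq (le j)).
    have := leif.2; rewrite Ei eqxx => /esym/forall_inP/(_ i (eqxx _)) => ge.
    by apply/eqP; rewrite eqn_leq le ge.
  apply/mnmP => i; rewrite -(fintype.splitK i).
  case: (fintype.split i) => j //=.
  by have := El j; rewrite !clique_exp_l eqr => /addIn.
rewrite negb_forall => /existsP[i]; rewrite -ltnNge => lti.
(* Both monomials have the same y-degree in the clique of [i], so the surplus at [i] is compensated
   by a deficit at some [j] of this clique. *)
have [j /eqP cj ltj] : exists2 j, c j == c i & (m (rshift n j) < m' (rshift n j))%N.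
  apply/exists_inP; apply: contraT; rewrite negb_exists_in => /forall_inP le.
  have {}le j : c j == c i -> (m' (rshift n j) <= m (rshift n j))%N.
    by move=> /le; rewrite -leqNgt.
  have leif := leqif_sum (P := fun j => c j == c i)
      (fun j cj => leqif_geq (le j cj)).
  have := leif.2; have := Er (c i); rewrite !clique_exp_r => ->.
  rewrite eqxx => /esym/forall_inP/(_ i (eqxx _)).
  by rewrite leqNgt lti.
have nij : i != j by apply: contraTneq lti => ->; rewrite -leqNgt ltnW.
have ltlj : (m' (lshift n j) < m (lshift n j))%N.
  by have := El j; rewrite !clique_exp_l; lia.
(* The product of y_i and x_j divides [m]: the total degree at [j] is the same in [m] and [m'], so
   the deficit in y_j leaves room for x_j. The swap gives [m1], which is closer to [m']. *)
pose m0 := (m - (U_(rshift n i) + U_(lshift n j)))%MM.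
have Em : m = (m0 + (U_(rshift n i) + U_(lshift n j)))%MM.
  rewrite submK //; apply/mnm_lepP => l; rewrite mnmDE !mnm1E.
  case: eqP => [<-|_]; first by rewrite eq_lrshift addn0; lia.
  by case: eqP => [<-|_]; lia.
pose m1 := (m0 + (U_(lshift n i) + U_(rshift n j)))%MM.
have m1r l : m1 (rshift n l) = (m0 (rshift n l) + (j == l))%N.
  by rewrite /m1 !mnmDE !mnm1E eq_lrshift eq_rshift.
have mr l : m (rshift n l) = (m0 (rshift n l) + (i == l))%N.
  by rewrite Em !mnmDE !mnm1E eq_lrshift eq_rshift addn0.
have m1l l : m1 (lshift n l) = (m0 (lshift n l) + (i == l))%N.
  by rewrite /m1 !mnmDE !mnm1E eq_rlshift eq_lshift addn0.
have ml l : m (lshift n l) = (m0 (lshift n l) + (j == l))%N.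
  by rewrite Em !mnmDE !mnm1E eq_rlshift eq_lshift.
rewrite -[_ - _](subrKA 'X_[m1]); apply: gen_idealD.
  rewrite {1}Em /m1 !mpolyXD -mulrBr gen_idealMl //.
  have -> : 'X_(rshift n i) * 'X_(lshift n j) - 'X_(lshift n i) * 'X_(rshift n j)
     = f j i by rewrite /edge_binomial /xvar /yvar; ring.
  by rewrite cut_ideal_edge // hc cj.
apply: IH.
  rewrite -ltnS; apply: leq_trans ltd; rewrite ltnS.
  rewrite [X in (X.+1 <= _)%N](bigD1 i) // [X in (_ <= X)%N](bigD1 i) //=.
  rewrite -addSn leq_add //.
    by move: lti; rewrite m1r mr eq_sym eqxx (negPf nij); lia.
  apply: leq_sum => l /negPf li; rewrite m1r mr eq_sym.
  by rewrite [i == l]eq_sym li; case: eqP => [lj|_]; [rewrite lj|]; move: ltj;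
    rewrite mr (negPf nij); lia.
rewrite -E; apply/mnmP => l; rewrite -(fintype.splitK l).
case: (fintype.split l) => {}l /=.
  rewrite !clique_exp_l m1r mr m1l ml; lia.
rewrite !clique_exp_r.
under eq_bigr do rewrite m1r. under [RHS]eq_bigr do rewrite mr.
rewrite !big_split /=; congr addn.
have sum1 u : (\sum_(v | c v == l) (u == v) = (c u == l))%N.
  rewrite big_mkcond /= (bigD1 u) //= eqxx big1 => [|v]; first by case: ifP.
  by rewrite eq_sym => /negPf ->; case: ifP.
by rewrite !sum1 cj.
Qed.

(** For each exponent [q] in the image, [nu q] is a fixed preimage. Replacing every monomial [m] of
    [g] by [nu (clique_exp m)] changes [g] by an element of the ideal. The result is 0, since its
    terms for a given [q] add up to the coefficient of [q] in [clique_param g]. *)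
Lemma clique_param_ker T g : clique_param g = 0 -> g \in cut_ideal h T.
Proof.
move=> g0.
pose nu q := if pselect (exists m, clique_exp m = q) is left P
  then projT1 (cid P) else 0%MM.
have nuP m : clique_exp (nu (clique_exp m)) = clique_exp m.
  rewrite /nu; case: pselect => [P|[]]; last by exists m.
  by case: (cid P).
have -> : g = \sum_(m <- msupp g) g@_m *: ('X_[m] - 'X_[nu (clique_exp m)]).
  under eq_bigr do rewrite scalerBr.
  rewrite sumrB -mpolyE -[LHS]subr0; congr (_ - _); apply/esym.
  pose s := undup [seq clique_exp m | m <- msupp g].
  have -> : \sum_(m <- msupp g) g@_m *: 'X_[nu (clique_exp m)] =
     \sum_(m <- msupp g) \sum_(q <- s | q == clique_exp m) g@_m *: 'X_[nu q].
    rewrite !big_seq; apply: eq_bigr => m mg.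
    rewrite (big_rem (clique_exp m)) /= ?mem_undup ?map_f // eqxx.
    rewrite big_seq_cond big1 ?addr0 // => q /andP[].
    by rewrite mem_rem_uniq ?undup_uniq // inE => /andP[/negPf ->].
  rewrite (exchange_big_dep xpredT) //= big1 // => q _.
  rewrite -scaler_suml.
  suff -> : \sum_(m <- msupp g | q == clique_exp m) g@_m = 0 by rewrite scale0r.
  transitivity ((clique_param g)@_q); last by rewrite g0 mcoeff0.
  rewrite [in RHS](mpolyE g) (raddf_sum clique_param) (raddf_sum (mcoeff q)) /=.
  rewrite big_mkcond; apply: eq_bigr => m _.
  rewrite -mul_mpolyC (rmorphM clique_param) /= {1}/clique_param xy_evalC.
  rewrite clique_param_mono mul_mpolyC mcoeffZ mcoeffX eq_sym.
  by case: eqP; rewrite ?mulr1 ?mulr0.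
rewrite gen_ideal_sum // => m _; rewrite -mul_mpolyC gen_idealMl //.
by rewrite clique_mono_congr.
Qed.

End CliqueUnion.
End CutIdeals.

(** * Regularity of edge binomials *)

Section SimplicialRegular.
Variables (k : fieldType) (n : nat).
Local Notation S := {mpoly k[n + n]}.
Local Notation x := (xvar k).
Local Notation y := (yvar k).
Local Notation f := (edge_binomial k).
Local Notation cut_ideal := (@cut_ideal k n).
Implicit Types (i j a b u v : 'I_n) (p g : S) (h : rel 'I_n) (T : {set 'I_n}).

Definition simplicial h a :=
  [forall b, forall c, h a b && h a c ==> h b c].

Lemma simplicialP h a :
  reflect (forall b c, h a b -> h a c -> h b c) (simplicial h a).
Proof.
apply: (iffP forallP) => [H b c ab ac|H b].
  by have /forallP/(_ c)/implyP := H b; rewrite ab ac; apply.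
by apply/forallP => c; apply/implyP => /andP[]; apply: H.
Qed.

Lemma complete_at_refl h v : reflexive h -> reflexive (complete_at h v).
Proof. by move=> hR a; rewrite /complete_at hR. Qed.

Lemma complete_at_sym h v :
  ssrbool.symmetric h -> ssrbool.symmetric (complete_at h v).
Proof. by move=> hC a b; rewrite /complete_at hC andbC. Qed.

Lemma delete_sym h v : ssrbool.symmetric h -> ssrbool.symmetric (delete h v).
Proof. by move=> hC a b; rewrite /delete eq_sym hC [_ && (b != _)]andbC. Qed.

Lemma simplicial_complete_at_self h v :
  reflexive h -> simplicial (complete_at h v) v.
Proof.
move=> hR; apply/simplicialP => b c; rewrite /complete_at hR /= !orbb => vb vc.
by rewrite vb vc orbT.
Qed.

Lemma simplicial_complete_at h v a : ssrbool.symmetric h ->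
  simplicial h a -> simplicial (complete_at h v) a.
Proof.
move=> hC /simplicialP ha; apply/simplicialP => b c.
rewrite /complete_at => /orP[ab|/andP[va vb]] /orP[ac|/andP[va' vc]].
- by rewrite (ha b c).
- by rewrite vc andbT [h v b]hC (ha b v) ?orbT // hC.
- by rewrite vb [h v c]hC (ha c v) ?orbT // hC.
- by rewrite vb vc orbT.
Qed.

Lemma simplicial_delete h v a : reflexive h ->
  simplicial h a -> simplicial (delete h v) a.
Proof.
move=> hR /simplicialP ha; apply/simplicialP => b c; rewrite /delete.
case: (eqVneq a b) => [<- //|_]; case: (eqVneq a c) => [<-|_] /=.
  by case/and3P => ab av bv _; rewrite av bv (ha b a) ?orbT.
by case/and3P => ab av bv /and3P[ac _ cv]; rewrite bv cv (ha b c) ?orbT.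
Qed.

Lemma simplicial_delete_self h v : simplicial (delete h v) v.
Proof.
apply/simplicialP => b c; rewrite /delete eqxx /= !andbF !orbF.
by move=> /eqP <- /eqP <-; rewrite eqxx.
Qed.

(** If all vertices are simplicial, [h] is an equivalence relation. After the variables in [T] are
    set to 0, the ideal is the kernel of a map to a domain, and [f u v] goes to x_u x_v (y_(c v) -
    y_(c u)), which is nonzero. *)
Lemma nzmod_clique_union h T u v g :
    reflexive h -> ssrbool.symmetric h -> (forall a, simplicial h a) ->
    u \notin T -> v \notin T -> ~~ h u v ->
  g * f u v \in cut_ideal h T -> g \in cut_ideal h T.
Proof.
move=> hR hC hS uT vT nuv gfI.
(* A representative of the class of [i]; [pick] returns the same element for equivalent vertices, as
   they have the same neighbours. *)
pose c i := odflt i [pick j | h i j].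
have hT a b d : h a b -> h a d -> h b d by have /simplicialP := hS a; apply.
have hci i : h i (c i).
  by rewrite /c; case: pickP => //= /(_ i); rewrite hR.
have hc i j : h i j = (c i == c j).
  apply/idP/eqP => [ij|cij]; last first.
    by apply: (hT (c i)); rewrite hC ?hci // cij hci.
  rewrite /c (@eq_pick _ _ (h j)); last first.
    by move=> l; apply/idP/idP; apply: hT; rewrite // hC.
  by case: pickP => //= /(_ j); rewrite hR.
suff kg : kill T g \in cut_ideal h T.
  rewrite -[g](subrK (kill T g)) gen_idealD // -[_ - _]mulr1.
  apply: sub_kill_mul => t tT; rewrite !mulr1.
  by rewrite cut_ideal_x ?cut_ideal_y.
apply: (clique_param_ker hc).
have kI p : p \in cut_ideal h T -> clique_param c (kill T p) = 0.
  move: p; apply: gen_ideal_ind => [|p q p0 q0|p q Eq].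
  - by rewrite kill0 rmorph0.
  - by rewrite killD rmorphD /= p0 q0 addr0.
  rewrite killM rmorphM /=.
  case: Eq => [[a [b [hab ->]]]|[t [tT [->|->]]]].
  - rewrite kill_f; case: ifP => _; first by rewrite rmorph0 mulr0.
    rewrite /clique_param xy_eval_f.
    by move: hab; rewrite hc => /eqP ->; ring.
  - by rewrite kill_x tT rmorph0 mulr0.
  - by rewrite kill_y tT rmorph0 mulr0.
have := kI _ gfI; rewrite killM kill_f (negPf uT) (negPf vT) /= rmorphM /=.
move/eqP; rewrite mulf_eq0 => /orP[/eqP -> //|].
rewrite {1}/clique_param xy_eval_f.
have -> : x u * (x v * y (c v)) - x v * (x u * y (c u))
  = x u * x v * (y (c v) - y (c u)) by ring.
have xn0 a : x a != 0.
  by apply/eqP => /(congr1 (mcoeff U_(lshift n a)))/eqP;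
     rewrite mcoeffXU eqxx mcoeff0 oner_eq0.
rewrite !mulf_eq0 !(negPf (xn0 _)) /= => /eqP/(congr1 (mcoeff U_(rshift n (c v))))/eqP.
rewrite mcoeffB !mcoeffXU eqxx mcoeff0 eq_rshift -hc (negPf nuv) subr0.
by rewrite oner_eq0.
Qed.

(* Induction on the number of non-simplicial vertices w, which decreases both
   when w is completed and when it is deleted. *)
Lemma edge_binomial_regular h T u v g (chi : 'I_n -> bool) :
    reflexive h -> ssrbool.symmetric h -> simplicial h u -> simplicial h v ->
    u \notin T -> v \notin T ->
    (forall a b, h a b -> chi a = chi b) -> chi u != chi v ->
  g * f u v \in cut_ideal h T -> g \in cut_ideal h T.
Proof.
have [d] := ubnP #|[set w | ~~ simplicial h w]|.
elim: d h T => // d IH h T ltd hR hC su sv uT vT hchi uv gfI.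
have [/forallP hS|] := boolP [forall w, simplicial h w].
  apply: nzmod_clique_union gfI => //.
  by apply: contra uv => /hchi ->.
rewrite negb_forall => /existsP[w nw].
have uw : u != w by apply: contraNneq nw => <-.
have vw : v != w by apply: contraNneq nw => <-.
have fewer (h' : rel 'I_n) : simplicial h' w ->
    (forall a, simplicial h a -> simplicial h' a) ->
    (#|[set a | ~~ simplicial h' a]| < d)%N.
  move=> sw hh'; rewrite -ltnS; apply: leq_trans ltd; rewrite ltnS.
  apply: proper_card; apply/properP; split.
    by apply/subsetP => a; rewrite !inE; apply/contra/hh'.
  by exists w; rewrite !inE ?sw.
(* That [u] and [v] are not connected is expressed by [chi], which is constant on components; it
   serves unchanged for both new graphs. *)
have hCw a b : complete_at h w a b -> chi a = chi b.
  by case/orP => [/hchi //|/andP[/hchi <- /hchi]].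
have hDw a b : delete h w a b -> chi a = chi b.
  by case/orP => [/eqP -> //|/and3P[/hchi]].
apply: (@cut_ideal_complete_delete k n h T w) => //.
  apply: (IH) => //.
  - apply: fewer; first exact: simplicial_complete_at_self.
    by move=> a; apply: simplicial_complete_at.
  - exact: complete_at_refl.
  - exact: complete_at_sym.
  - exact: simplicial_complete_at.
  - exact: simplicial_complete_at.
  - by apply: cut_ideal_sub gfI => a b hab; rewrite /complete_at hab.
apply: (IH) => //.
- apply: fewer; first exact: simplicial_delete_self.
  by move=> a; apply: simplicial_delete.
- by move=> a; rewrite /delete eqxx.
- exact: delete_sym.
- exact: simplicial_delete.
- exact: simplicial_delete.
- by rewrite in_setU1 negb_or uw.
- by rewrite in_setU1 negb_or vw.
(* The ideal of [h] is contained in the new one, because the edge binomials at [w] lie in (x_w,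
   y_w). *)
move: gfI; apply: gen_ideal_sub => _ [[a [b [hab ->]]]|[t [tT [->|->]]]].
- have [->|aw] := eqVneq a w.
    rewrite /edge_binomial gen_idealB //.
      by rewrite gen_idealMr ?cut_ideal_x ?setU11.
    by rewrite gen_idealMl ?cut_ideal_y ?setU11.
  have [->|bw] := eqVneq b w.
    rewrite /edge_binomial gen_idealB //.
      by rewrite gen_idealMl ?cut_ideal_y ?setU11.
    by rewrite gen_idealMr ?cut_ideal_x ?setU11.
  by rewrite cut_ideal_edge // /delete hab aw bw orbT.
- by rewrite cut_ideal_x // in_setU1 tT orbT.
- by rewrite cut_ideal_y // in_setU1 tT orbT.
Qed.

End SimplicialRegular.

(** * Colon ideals by an edge binomial *)

Section EdgeColon.
Variables (k : fieldType) (n : nat).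
Local Notation S := {mpoly k[n + n]}.
Local Notation x := (xvar k).
Local Notation y := (yvar k).
Local Notation f := (edge_binomial k).
Local Notation cut_ideal := (@cut_ideal k n).
Implicit Types (g : S) (h : rel 'I_n) (T : {set 'I_n}).

Definition complete2 h u v := complete_at (complete_at h u) v.

(** As [u] and [v] are not adjacent, completing at [u] leaves the neighbours of [v] unchanged. For a
    new edge {a, b} from the neighbourhood of [u], both x_u f_ab and y_u f_ab are in J(h), and
    [f u v] is a combination of x_u and y_u; likewise for [v]. *)
Lemma complete2_mul h T u v g : ~~ h u v ->
  g \in cut_ideal (complete2 h u v) T -> g * f u v \in cut_ideal h T.
Proof.
move=> nuv; move: g; apply: gen_ideal_ind => [|p q pI qI|c g Eg].
- by rewrite mul0r gen_ideal0.
- by rewrite mulrDl gen_idealD.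
rewrite -mulrA gen_idealMl //; case: Eg => [[a [b [hab ->]]]|[t [tT [->|->]]]].
- have hvE : complete_at h u v =1 h v.
    by move=> d; rewrite /complete_at (negPf nuv) orbF.
  move: hab; rewrite /complete2 {1}/complete_at !hvE.
  case/orP => [/orP[hab|/andP[ua ub]]|/andP[va vb]].
  + by rewrite gen_idealMr ?cut_ideal_edge.
  + have [xI yI] := cut_ideal_complete_mul k T ua ub.
    have -> : f a b * f u v = y v * (x u * f a b) - x v * (y u * f a b).
      by rewrite /edge_binomial; ring.
    by apply: gen_idealB; apply: gen_idealMl; [exact: xI|exact: yI].
  + have [xI yI] := cut_ideal_complete_mul k T va vb.
    have -> : f a b * f u v = x u * (y v * f a b) - y u * (x v * f a b).
      by rewrite /edge_binomial; ring.
    by apply: gen_idealB; apply: gen_idealMl; [exact: yI|exact: xI].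
- by rewrite gen_idealMr ?cut_ideal_x.
- by rewrite gen_idealMr ?cut_ideal_y.
Qed.

(** In [complete2 h u v] all of [p], [q], [u], [v] are simplicial, so both [f u v] and [f p q] can
    be cancelled modulo its ideal. This puts [g] in that ideal, which [f u v] multiplies back into
    J(h). *)
Lemma edge_binomial_colon h T p q u v g (chi chi' : 'I_n -> bool) :
    reflexive h -> ssrbool.symmetric h ->
    p \notin T -> q \notin T -> u \notin T -> v \notin T ->
    (forall a b, h a b -> chi a = chi b) -> chi p != chi q ->
    (forall a b, h a b -> chi' a = chi' b) -> chi' u != chi' v ->
    simplicial h p || (p \in [:: u; v]) -> simplicial h q || (q \in [:: u; v]) ->
  g * (f p q * f u v) \in cut_ideal h T -> g * f u v \in cut_ideal h T.
Proof.
move=> hR hC pT qT uT vT hchi pq hchi' uv sp sq gI.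
have cR := complete_at_refl u hR.
have cC := complete_at_sym u hC.
have su : simplicial (complete2 h u v) u.
  by apply: simplicial_complete_at; last exact: simplicial_complete_at_self.
have sv : simplicial (complete2 h u v) v.
  exact: simplicial_complete_at_self.
have s2 a : simplicial h a || (a \in [:: u; v]) -> simplicial (complete2 h u v) a.
  case/orP => [sa|]; last by rewrite !inE => /orP[] /eqP ->.
  by apply: simplicial_complete_at => //; apply: simplicial_complete_at.
have mono (c : 'I_n -> bool) : (forall a b, h a b -> c a = c b) ->
    forall a b, complete2 h u v a b -> c a = c b.
  move=> hc a b; rewrite /complete2 /complete_at.
  have H1 a1 b1 : h a1 b1 || h u a1 && h u b1 -> c a1 = c b1.
    by case/orP => [/hc //|/andP[/hc <- /hc]].
  by case/orP => [/H1 //|/andP[/H1 <- /H1]].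
have R2 : reflexive (complete2 h u v) by apply: complete_at_refl.
have C2 : ssrbool.symmetric (complete2 h u v) by apply: complete_at_sym.
apply: complete2_mul; first by apply: contra uv => /hchi' ->.
apply: (@edge_binomial_regular k n _ T p q g chi) => //;
  [exact: s2|exact: s2|exact: mono|].
apply: (@edge_binomial_regular k n _ T u v _ chi') => //; first exact: mono.
rewrite -mulrA; apply: cut_ideal_sub gI => a b hab.
by rewrite /complete2 /complete_at hab.
Qed.

End EdgeColon.

(** * Colourings of a tree with an edge or a vertex removed *)

Section TreeColorings.
Variables (n : nat) (e : rel 'I_n).
Hypothesis e_tree : is_tree e.

Let eC : ssrbool.symmetric e. Proof. by case: e_tree => _ []. Qed.
Let eI : irreflexive e. Proof. by case: e_tree => _ []. Qed.
Let e_acyclic c : (2 < size c)%N -> ~~ ucycleb e c.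
Proof. by case: e_tree => _ _ _; apply. Qed.

Lemma connect_coloring (e' : rel 'I_n) u a b : ssrbool.symmetric e' ->
  e' a b -> connect e' u a = connect e' u b.
Proof.
move=> sym ab; apply/idP/idP => ua; apply: connect_trans ua _.
  exact: connect1.
by rewrite connect1 // sym.
Qed.

Lemma tree_edge_coloring u v : e u v ->
  exists chi : 'I_n -> bool, chi u != chi v /\
    forall a b, e a b -> (a, b) != (u, v) -> (a, b) != (v, u) -> chi a = chi b.
Proof.
move=> uv; pose e' a b := [&& e a b, (a, b) != (u, v) & (a, b) != (v, u)].
have e'C : ssrbool.symmetric e'.
  by move=> a b; rewrite /e' eC !xpair_eqE -!negb_or orbC
    [(b == _) && _]andbC [(b == v) && _]andbC.
exists (connect e' u); split; last first.
  by move=> a b ab abuv abvu; apply: connect_coloring => //; rewrite /e' ab abuv.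
rewrite connect0; apply/negP => /eqP/esym/connectP[p0 pp vp].
case: (shortenP pp) vp => p pp' pU _ vp.
have pe : path e u p by apply: sub_path pp' => a b /and3P[].
have /negP[] : ~~ ucycleb e (u :: p).
  apply: e_acyclic; case: p vp pp' {pU pe} => [|a [|//]] /= vE.
    by rewrite vE eI in uv.
  by rewrite /e' vE eqxx andbF.
by rewrite /ucycleb pU andbT /= rcons_path pe -vp eC uv.
Qed.

(** A path from [w1] to [w2] avoiding [p] would form a cycle together with [p], so the component of
    [w1] in the tree minus [p] is a suitable colour class. *)
Lemma tree_vertex_coloring p w1 w2 : e p w1 -> e p w2 -> w1 != w2 ->
  exists chi : 'I_n -> bool, chi w1 != chi w2 /\
    forall a b, e a b -> a != p -> b != p -> chi a = chi b.
Proof.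
move=> pw1 pw2 w12; pose e' a b := [&& e a b, a != p & b != p].
have e'C : ssrbool.symmetric e' by move=> a b; rewrite /e' eC [(a != _) && _]andbC.
exists (connect e' w1); split; last first.
  by move=> a b ab ap bp; apply: connect_coloring => //; rewrite /e' ab ap.
rewrite connect0; apply/negP => /eqP/esym/connectP[q0 qq vq].
case: (shortenP qq) vq => q qq' qU _ vq.
have qe : path e w1 q by apply: sub_path qq' => a b /and3P[].
have /negP[] : ~~ ucycleb e (p :: w1 :: q).
  by apply: e_acyclic; case: q vq {qq' qU qe} w12 => //= ->; rewrite ?eqxx.
rewrite /ucycleb cons_uniq qU andbT /= pw1 rcons_path qe -vq eC pw2 /=.
rewrite inE; apply/negP => /orP[/eqP pE|]; first by rewrite pE eI in pw1.
suff : all (fun a => a != p) q by move/allP => qp /qp; rewrite eqxx.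
elim: q w1 qq' {qU qe vq qq pw1 w12 e'C} => //= a q IH w1 /andP[/and3P[_ _ ->]].
exact: IH.
Qed.

End TreeColorings.

(** * d-sequences and good orders *)

Section ColorEval.
Variables (k : fieldType) (n : nat) (chi : 'I_n -> bool) (Z : {pred 'I_n}).
Local Notation f := (edge_binomial k).

(* The point with (x i, y i) = (1, 0) or (0, 1) according to the colour of i,
   and (0, 0) for i in Z. *)
Definition color_eval : {mpoly k[n + n]} -> k :=
  xy_eval idfun (fun i => (chi i && (i \notin Z))%:R)
                (fun i => (~~ chi i && (i \notin Z))%:R).
HB.instance Definition _ := GRing.RMorphism.on color_eval.

Lemma color_eval_f a b :
  (color_eval (f a b) != 0) = [&& chi a != chi b, a \notin Z & b \notin Z].
Proof.
rewrite /color_eval xy_eval_f.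
by case: (chi a) (chi b) (a \in Z) (b \in Z) => [] [] [] [] /=;
  rewrite ?(mul0r, mulr0, mul1r, subr0, sub0r, subrr) ?oppr_eq0 ?eqxx ?oner_eq0.
Qed.

Lemma color_eval_gen (A : {mpoly k[n + n]} -> Prop) g :
    (forall g, A g -> color_eval g = 0) ->
  g \in gen_ideal A -> color_eval g = 0.
Proof.
move=> A0; move: g; apply: gen_ideal_ind => [|p q p0 q0|c p /A0 p0].
- exact: rmorph0.
- by rewrite rmorphD /= p0 q0 addr0.
- by rewrite rmorphM /= p0 mulr0.
Qed.

End ColorEval.

Section DSequenceOrder.
Variables (k : fieldType) (n : nat) (e : rel 'I_n).
Hypothesis e_tree : is_tree e.
Local Notation cut_ideal := (@cut_ideal k n).
Local Notation f := (edge_binomial k).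
Implicit Types (d : 'I_n * 'I_n) (s : seq ('I_n * 'I_n)) (p : 'I_n).

Let eC : ssrbool.symmetric e. Proof. by case: e_tree => _ []. Qed.
Let eI : irreflexive e. Proof. by case: e_tree => _ []. Qed.

Definition edge_list :=
  enum [pred ij : 'I_n * 'I_n | (ij.1 < ij.2)%N && e ij.1 ij.2].
Definition edge_poly d := f d.1 d.2.
Definition incident p d := (p == d.1) || (p == d.2).
Definition graph_of s : rel 'I_n :=
  fun a b => [|| a == b, (a, b) \in s | (b, a) \in s].

Definition good_order s := forall s1 d s2, s = s1 ++ d :: s2 ->
  forall d' p, d' \in d :: s2 -> incident p d ->
    (1 < count (incident p) s1)%N -> incident p d'.

Lemma mem_edge_list d : (d \in edge_list) = (d.1 < d.2)%N && e d.1 d.2.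
Proof. by rewrite mem_enum inE. Qed.

Lemma graph_of_refl s : reflexive (graph_of s).
Proof. by move=> a; rewrite /graph_of eqxx. Qed.

Lemma graph_of_sym s : ssrbool.symmetric (graph_of s).
Proof. by move=> a b; rewrite /graph_of eq_sym [X in _ || X]orbC. Qed.

Lemma seq_ideal_graph s :
  seq_ideal [seq edge_poly d | d <- s] =i cut_ideal (graph_of s) set0.
Proof.
move=> g; apply/idP/idP; apply: gen_ideal_sub => {}g.
  move=> /mapP[[a b] ds ->]; apply: cut_ideal_edge.
  by rewrite /graph_of ds orbT.
case=> [[a [b [/or3P[/eqP ->|ab|ba] ->]]]|[t []]]; last by rewrite inE.
- by rewrite edge_binomial_diag gen_ideal0.
- by apply: mem_gen_ideal; apply/mapP; exists (a, b).
- rewrite edge_binomialC gen_idealN //.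
  by apply: mem_gen_ideal; apply/mapP; exists (b, a).
Qed.

Lemma graph_of_edge s a b : {subset s <= edge_list} ->
  graph_of s a b -> a = b \/ e a b.
Proof.
move=> sE /or3P[/eqP ->|/sE|/sE]; first by left.
  by rewrite mem_edge_list => /andP[]; right.
by rewrite mem_edge_list eC => /andP[]; right.
Qed.

Lemma edge_coloring s d : {subset s <= edge_list} -> d \in edge_list ->
    d \notin s ->
  exists chi : 'I_n -> bool, chi d.1 != chi d.2 /\
    forall a b, graph_of s a b -> chi a = chi b.
Proof.
case: d => u v sE; rewrite mem_edge_list => /= /andP[ltuv uv] ds.
have [chi [chiuv chiE]] := tree_edge_coloring e_tree uv.
exists chi; split=> //.
have H a b : (a, b) \in s -> chi a = chi b.
  move=> abs; have := sE _ abs; rewrite mem_edge_list /= => /andP[ltab ab].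
  apply: chiE => //; first by apply: contraNneq ds => <-.
  by apply: contraTneq ltab => -[-> ->]; rewrite -leqNgt ltnW.
by move=> a b /or3P[/eqP -> //|/H //|/H ->].
Qed.

Lemma edge_poly_inj : {in edge_list &, injective edge_poly}.
Proof.
move=> d d' dE d'E Ed; apply/eqP; apply: contraT => dd'.
have [||chi [chid chid']] := @edge_coloring [:: d'] d _ dE.
- by move=> z; rewrite inE => /eqP ->.
- by rewrite inE.
have : @color_eval k n chi pred0 (edge_poly d) != 0 by rewrite color_eval_f chid.
rewrite Ed color_eval_f (chid' d'.1 d'.2) ?eqxx //.
by rewrite /graph_of -surjective_pairing inE eqxx orbT.
Qed.

(** If the edge [d] is left out, a colouring that separates only the ends of [d] gives a point where
    all the remaining binomials vanish, but the one of [d] does not. *)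
Lemma edge_minimal_generators s : uniq s -> {subset s <= edge_list} ->
  minimal_generators [seq edge_poly d | d <- s].
Proof.
move=> sU sE b bs eqI.
have U : uniq [seq edge_poly d | d <- s].
  by rewrite map_inj_in_uniq // => d d' /sE dE /sE; apply: edge_poly_inj.
apply/eqP; rewrite -(size_subseq_leqif bs) eqn_leq size_subseq //=.
apply: uniq_leq_size => // _ /mapP[d ds ->]; apply: contraT => db.
have [||chi [chid chiE]] := @edge_coloring (rem d s) d _ (sE _ ds).
- by move=> z /mem_rem /sE.
- by rewrite mem_rem_uniq // inE eqxx.
have : @color_eval k n chi pred0 (edge_poly d) = 0.
  apply: (@color_eval_gen k n chi pred0 (fun g => g \in b)).
    move=> g gb; have /mapP[d' d's gE] := mem_subseq bs gb.
    apply/eqP; rewrite -[_ == _]negbK gE color_eval_f (chiE d'.1 d'.2) ?eqxx //.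
    rewrite /graph_of -surjective_pairing mem_rem_uniq // inE d's.
    by rewrite (contraNneq _ db) ?orbT // => <-; rewrite -gE.
  rewrite -[_ \in _]/(edge_poly d \in seq_ideal b) eqI.
  by apply: mem_gen_ideal; apply: map_f.
by move/eqP; rewrite -[_ == _]negbK color_eval_f chid.
Qed.

Lemma simplicial_graph_of s p :
  (count (incident p) s <= 1)%N -> simplicial (graph_of s) p.
Proof.
move=> cnt; apply/simplicialP => b c.
have H a : graph_of s p a -> a = p \/
    exists2 d, d \in filter (incident p) s & d = (p, a) \/ d = (a, p).
  case/or3P => [/eqP <-|ds|ds]; [by left|right|right].
    by exists (p, a); [rewrite mem_filter ds /incident eqxx|left].
  by exists (a, p); [rewrite mem_filter ds /incident eqxx orbT|right].
move=> pb pc; case: (H _ pb) => [->|[d ds dE]] //.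
case: (H _ pc) => [->|[d' d's d'E]]; first by rewrite graph_of_sym.
have : d = d'.
  apply/eqP; apply: contraLR cnt => dd'; rewrite -ltnNge -size_filter.
  have : uniq [:: d; d'] by rewrite /= inE dd'.
  by move/uniq_leq_size; apply => z; rewrite !inE => /orP[] /eqP ->.
case: dE d'E => -> [] -> => [[->]|[<- ->]|[-> <-]|[->]]; exact: graph_of_refl.
Qed.

Lemma good_order_d_sequence s : uniq s -> {subset s <= edge_list} ->
  (0 < size s)%N -> good_order s -> d_sequence [seq edge_poly d | d <- s].
Proof.
move=> sU sE s0 sG; split; first by rewrite size_map.
  exact: edge_minimal_generators.
move=> i j; rewrite size_map => /andP[ij js] g.
have [d0 _] : exists d0 : 'I_n * 'I_n, true.
  by case: (s) s0 => // d0 *; exists d0.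
have is_ := leq_ltn_trans ij js.
rewrite !mem_colon -map_take !(nth_map d0) //.
rewrite !seq_ideal_graph.
apply/idP/idP; last by rewrite mulrCA => H; apply: gen_idealMl.
have U : uniq (take i s ++ drop i s) by rewrite cat_take_drop.
have dj : nth d0 s j \in drop i s.
  by rewrite -[in nth _ _ _](subnKC ij) -nth_drop mem_nth // size_drop ltn_sub2r.
have di : nth d0 s i \in drop i s.
  by rewrite -[in nth _ _ _](addn0 i) -nth_drop mem_nth // size_drop subn_gt0.
have nt z : z \in drop i s -> z \notin take i s.
  by move: U; rewrite cat_uniq => /and3P[_ /hasPn H _] /H.
have tE : {subset take i s <= edge_list} by move=> z /mem_take /sE.
have [chi [c1 c1E]] := edge_coloring tE (sE _ (mem_nth d0 is_)) (nt _ di).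
have [chi' [c2 c2E]] := edge_coloring tE (sE _ (mem_nth d0 js)) (nt _ dj).
(* An end [p] of edge [i] with at most one earlier edge is simplicial. Otherwise edge [i] comes
   third or later at [p], and goodness makes [p] an end of edge [j]. *)
have spl p : incident p (nth d0 s i) ->
    simplicial (graph_of (take i s)) p ||
    (p \in [:: (nth d0 s j).1; (nth d0 s j).2]).
  move=> pi; have [/simplicial_graph_of -> //|gt] :=
    leqP (count (incident p) (take i s)) 1.
  apply/orP; right; rewrite !inE.
  apply: (sG (take i s) (nth d0 s i) (drop i.+1 s)) gt => //.
    by rewrite -drop_nth ?cat_take_drop.
  by rewrite -drop_nth.
apply: edge_binomial_colon c1E c1 c2E c2 _ _ => //; rewrite ?in_set0 //.
- exact: graph_of_refl.
- exact: graph_of_sym.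
- by apply: spl; rewrite /incident eqxx.
- by apply: spl; rewrite /incident eqxx orbT.
Qed.

Definition other p d := if p == d.1 then d.2 else d.1.

Lemma otherP p d : incident p d -> d = (p, other p d) \/ d = (other p d, p).
Proof.
case: d => a b; rewrite /incident /other /=.
by case: eqVneq => [<- _|_ /eqP <-]; [left|right].
Qed.

Lemma good_order_necessary s : uniq s -> {subset s <= edge_list} ->
  d_sequence [seq edge_poly d | d <- s] -> good_order s.
Proof.
move=> sU sE [_ _ dseq] s1 d s2 sdef d' p d'd pd cnt.
apply: contraT => npd'.
have s1E : {subset s1 <= edge_list}.
  by move=> z zs; apply: sE; rewrite sdef mem_cat zs.
have d'E : d' \in edge_list by apply: sE; rewrite sdef mem_cat d'd orbT.
have d's1 : d' \notin s1.
  by move: sU; rewrite sdef cat_uniq => /and3P[_ /hasPn/(_ _ d'd) ? _].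
have [d1 [d2 [d1s d2s d12]]] : exists d1 d2,
   [/\ d1 \in filter (incident p) s1, d2 \in filter (incident p) s1 & d1 != d2].
  have : uniq (filter (incident p) s1).
    by rewrite filter_uniq //; move: sU; rewrite sdef cat_uniq => /and3P[].
  move: cnt; rewrite -size_filter; case: (filter _ _) => [//|d1 [//|d2 r]] _.
  rewrite /= inE negb_or => /andP[/andP[d12 _] _].
  by exists d1, d2; rewrite !inE !eqxx ?orbT.
move: d1s d2s; rewrite !mem_filter => /andP[pd1 d1s] /andP[pd2 d2s].
pose w1 := other p d1; pose w2 := other p d2.
have adj d0 : incident p d0 -> d0 \in s1 ->
    e p (other p d0) /\ graph_of s1 p (other p d0).
  move=> pd0 d0s; have := s1E _ d0s; rewrite mem_edge_list /graph_of => /andP[_].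
  by case: (otherP pd0) d0s => {1 2 3}-> /= -> ep; rewrite ?orbT // eC.
have [e1 g1] := adj _ pd1 d1s; have [e2 g2] := adj _ pd2 d2s.
have w12 : w1 != w2.
  apply: contra d12 => /eqP w12; have := s1E _ d1s; have := s1E _ d2s.
  rewrite !mem_edge_list => /andP[l2 _] /andP[l1 _].
  move: (otherP pd1) (otherP pd2) w12 l1 l2; rewrite /w1 /w2.
  move: (other p d1) (other p d2) => o1 o2.
  case=> -> [] -> -> /= l1 l2; rewrite ?eqxx //.
    by move: l2; rewrite ltnNge (ltnW l1).
  by move: l2; rewrite ltnNge (ltnW l1).
have plucker : f w1 w2 * edge_poly d \in cut_ideal (graph_of s1) set0.
  have H u : f w1 w2 * f p u \in cut_ideal (graph_of s1) set0.
    rewrite edge_binomial_plucker.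
    apply: gen_idealB; [apply: gen_idealMl|apply: gen_idealMr].
      by apply: cut_ideal_edge; rewrite graph_of_sym.
    by apply: cut_ideal_edge; rewrite graph_of_sym.
  case: (otherP pd) => ->; rewrite /edge_poly /=; first exact: H.
  by rewrite [f _ p]edge_binomialC mulrN; apply: gen_idealN; apply: H.
have colon : f w1 w2 * edge_poly d' \in cut_ideal (graph_of s1) set0.
  have lt1 : (size s1 < size s)%N by rewrite sdef size_cat /= -addSnnS leq_addr.
  have lt2 : (size s1 + index d' (d :: s2) < size s)%N.
    by rewrite sdef size_cat ltn_add2l index_mem.
  have ij : (size s1 <= size s1 + index d' (d :: s2)
               < size [seq edge_poly d | d <- s])%N.
    by rewrite leq_addr size_map.
  have := dseq _ _ ij (f w1 w2).
  rewrite !mem_colon -map_take !(nth_map d) //.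
  rewrite sdef take_size_cat // nth_cat ltnn subnn /=.
  rewrite nth_cat ltnNge leq_addr /= addKn nth_index //.
  rewrite !seq_ideal_graph => <-.
  by rewrite mulrA gen_idealMr.
have [c1 [c1d' c1E]] := edge_coloring s1E d'E d's1.
have [c2 [c2w c2E]] := tree_vertex_coloring e_tree e1 e2 w12.
have {}c2E a b : graph_of s1 a b -> a != p -> b != p -> c2 a = c2 b.
  by case/(graph_of_edge s1E) => [-> //|]; apply: c2E.
(* One colouring must separate both [w1, w2] and the ends of [d']. If neither [c1] nor [c2] does,
   each separates exactly one of these pairs, and their sum modulo 2 separates both. *)
have [chi [chiw chid' chiE]] : exists chi : 'I_n -> bool,
  [/\ chi w1 != chi w2, chi d'.1 != chi d'.2 &
    forall a b, graph_of s1 a b -> a != p -> b != p -> chi a = chi b].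
  have [E1|N1] := eqVneq (c1 w1) (c1 w2); last first.
    by exists c1; split=> // a b /c1E.
  have [E2|N2] := eqVneq (c2 d'.1) (c2 d'.2); last by exists c2.
  exists (fun a => c1 a (+) c2 a); split.
  - by rewrite E1 (inj_eq (@addbI _)).
  - by rewrite E2 (inj_eq (@addIb _)).
  - by move=> a b ab ap bp; rewrite (c1E a b) // (c2E a b).
(* At this point the coordinates of [p] are 0, so earlier edges at [p] vanish, and the other earlier
   edges have ends of equal colour. Neither factor of the product vanishes there, a
   contradiction. *)
have : @color_eval k n chi (pred1 p) (f w1 w2 * edge_poly d') = 0.
  move: colon; apply: color_eval_gen => g [[a [b [ab ->]]]|[t []]];
    last by rewrite inE.
  apply/eqP; rewrite -[_ == _]negbK color_eval_f !inE.
  have [//|ap] := eqVneq a p; first by rewrite andbF.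
  have [//|bp] := eqVneq b p; first by rewrite !andbF.
  by rewrite (chiE a b) ?eqxx.
rewrite rmorphM /= => /eqP; rewrite mulf_eq0.
rewrite -[X in X || _]negbK -[X in _ || X]negbK.
rewrite !color_eval_f chiw chid' !inE /=.
have neqp d0 : d0 \in s1 -> incident p d0 -> other p d0 != p.
  move=> /s1E; rewrite mem_edge_list => /andP[_ e0] pd0.
  apply: contraTneq e0 => E0; rewrite /other in E0 *.
  by case: (otherP pd0) => ->; rewrite /other E0 /= eI.
rewrite !neqp //=; move: npd'; rewrite /incident negb_or ![p == _]eq_sym.
by case/andP => -> ->.
Qed.

End DSequenceOrder.

(** * Good orders and degree sequences *)

Local Open Scope nat_scope.

Lemma nth_count_split (T : Type) (P : pred T) m (s : seq T) :
    (m < count P s)%N ->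
  exists s1 d s2, [/\ s = s1 ++ d :: s2, P d & count P s1 = m].
Proof.
elim: s m => //= a s IH m; case: (boolP (P a)) => Pa.
  case: m => [|m] /=; first by exists [::], a, s.
  rewrite add1n ltnS => /IH[s1 [d [s2 [-> Pd cnt]]]].
  by exists (a :: s1), d, s2; rewrite /= Pa cnt.
rewrite add0n => /IH[s1 [d [s2 [-> Pd cnt]]]].
by exists (a :: s1), d, s2; rewrite /= (negPf Pa) cnt.
Qed.

Lemma sorted_geq_small (t : seq nat) : sorted geq t ->
  all (fun d => 0 < d <= 2) t -> exists p q, t = nseq p 2 ++ nseq q 1.
Proof.
elim: t => [|a t IH] /=; first by exists 0, 0.
move=> pt /andP[a12 t12].
have [p [q tE]] := IH (path_sorted pt) t12.
have [-> |a1] : a = 2 \/ a = 1 by lia.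
  by exists p.+1, q; rewrite tE.
exists 0, q.+1; rewrite a1; case: p tE => [-> //|p tE].
by move: pt; rewrite tE a1 /=.
Qed.

Lemma filter_enum_ord n (P : pred 'I_n) : [seq i <- enum 'I_n | P i] = enum P.
Proof. by rewrite !enumT /= /enum_mem; apply: eq_filter => i. Qed.

Section TreeDegrees.
Variables (n : nat) (e : rel 'I_n).
Hypothesis e_tree : is_tree e.
Implicit Types (p u v w : 'I_n) (d : 'I_n * 'I_n) (s : seq ('I_n * 'I_n)).

Let eC : ssrbool.symmetric e. Proof. by case: e_tree => _ []. Qed.
Let eI : irreflexive e. Proof. by case: e_tree => _ []. Qed.
Let eK u v : connect e u v. Proof. by case: e_tree => _ _ ->. Qed.
Let n_gt0 : 0 < n. Proof. by case: e_tree. Qed.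

Local Notation branch := [pred v | 2 < degree e v].

Lemma uniq_edge_list : uniq (edge_list e). Proof. exact: enum_uniq. Qed.

Lemma edge_in_list u v : e u v ->
  exists d, [/\ d \in edge_list e, incident u d & incident v d].
Proof.
move=> uv; have : val u != val v by apply: contraTneq uv => /val_inj ->; rewrite eI.
rewrite neq_ltn => /orP[ltuv|ltvu]; [exists (u, v)|exists (v, u)];
  by rewrite mem_edge_list /incident /= !eqxx ?orbT /= ?(eC v u) ?uv ?ltuv ?ltvu.
Qed.

Lemma incident2_eq u v d d' : d \in edge_list e -> d' \in edge_list e -> u != v ->
  incident u d -> incident v d -> incident u d' -> incident v d' -> d = d'.
Proof.
case: d d' => [a b] [a' b']; rewrite !mem_edge_list /incident /=.
move=> /andP[lt _] /andP[lt' _] uv.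
move=> /orP[] /eqP Ea /orP[] /eqP Eb /orP[] /eqP Ea' /orP[] /eqP Eb'; subst;
  rewrite ?eqxx // in uv; subst => //; by move: lt; rewrite ltnNge (ltnW lt').
Qed.

Lemma incident2_edge u v d : d \in edge_list e -> u != v ->
  incident u d -> incident v d -> e u v.
Proof.
case: d => a b; rewrite mem_edge_list /incident /= => /andP[_ ab] uv.
by case/orP=> /eqP Ea /orP[] /eqP Eb; subst; rewrite ?eqxx // in uv; rewrite eC.
Qed.

Lemma degree_count p s : perm_eq s (edge_list e) ->
  degree e p = count (incident p) s.
Proof.
move/permP ->; rewrite -size_filter.
have /card_uniqP <- : uniq (filter (incident p) (edge_list e)).
  by rewrite filter_uniq ?uniq_edge_list.
pose g w := if p < w then (p, w) else (w, p).
have gK : cancel g (other p).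
  move=> w; rewrite /g /other; case: ltnP => _ /=; first by rewrite eqxx.
  by case: eqP.
rewrite /degree -(card_imset _ (can_inj gK)); apply: eq_card => d.
rewrite mem_filter mem_edge_list; apply/imsetP/idP => [[w]|/and3P[pd lt ed]].
  rewrite inE => pw ->; rewrite /g /incident; case: (ltngtP p w) => [lt|lt|E] /=.
  - by rewrite eqxx lt pw.
  - by rewrite eqxx orbT lt eC pw.
  - by rewrite (val_inj E) eI in pw.
move: (otherP pd) lt ed; move: (other p d) => o [] -> /= lt ed; exists o;
  by rewrite ?inE // /g ?lt // 1?eC // ltnNge (ltnW lt).
Qed.

(** Let [v1] be the one of the two vertices whose third edge comes first, or at the same place, and
    [v2] the other. From the third edge of [v2] on, all edges contain [v1]. Only one edge contains
    both, so the third edge of [v2] is {v1, v2} and is its last. *)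
Lemma branch_pair s v w : perm_eq s (edge_list e) -> good_order s ->
    v != w -> branch v -> branch w ->
  e v w /\ (degree e v = 3 \/ degree e w = 3).
Proof.
move=> sE sG.
have sub z : z \in s -> z \in edge_list e by rewrite (perm_mem sE).
have sU : uniq s by rewrite (perm_uniq sE) uniq_edge_list.
have aux v1 v2 s1 d s2 s1' d' s2' : v1 != v2 -> 2 < degree e v2 ->
    s = s1 ++ d :: s2 -> incident v1 d -> count (incident v1) s1 = 2 ->
    s = s1' ++ d' :: s2' -> incident v2 d' -> count (incident v2) s1' = 2 ->
    size s1 <= size s1' -> e v1 v2 /\ degree e v2 = 3.
  move=> v12 big def1 i1 c1 def2 i2 c2 le12.
  have v1i z : z \in d' :: s2' -> incident v1 z.
    move=> zs; apply: (sG s1 d s2 def1) => //; last by rewrite c1.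
    have dr1 : drop (size s1) s = d :: s2 by rewrite def1 drop_size_cat.
    have dr2 : drop (size s1') s = d' :: s2' by rewrite def2 drop_size_cat.
    rewrite -dr1; apply: (@mem_drop (size s1' - size s1)).
    by rewrite drop_drop subnK // dr2.
  have s2E z : z \in d' :: s2' -> z \in edge_list e.
    by move=> zs; apply: sub; rewrite def2 mem_cat zs orbT.
  have d'0 : d' \in d' :: s2' by rewrite inE eqxx.
  split; first by apply: (incident2_edge (s2E _ d'0)) => //; apply: v1i.
  apply/eqP; rewrite eqn_leq big andbT (degree_count _ sE) def2 count_cat c2.
  rewrite (@leq_add2l 2 _ 1).
  have -> : count (incident v2) (d' :: s2') = count_mem d' (d' :: s2').
    apply: eq_in_count => z zs; apply/idP/eqP => [iz|-> //].
    by apply: (incident2_eq (s2E _ zs) (s2E _ d'0) v12); rewrite ?v1i.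
  rewrite count_uniq_mem ?leq_b1 //.
  by move: sU; rewrite def2 cat_uniq => /and3P[].
move=> vw /= bv bw; have := bv; have := bw; rewrite !(degree_count _ sE).
move=> /nth_count_split[s1' [d' [s2' [def' i' c']]]].
move=> /nth_count_split[s1 [d [s2 [def i c]]]].
case: (leqP (size s1) (size s1')) => [le|/ltnW le].
  have [ewv d3] := aux v w _ _ _ _ _ _ vw bw def i c def' i' c' le.
  by split=> //; rewrite -!(degree_count _ sE); right.
have wv : w != v by rewrite eq_sym.
have [ewv d3] := aux w v _ _ _ _ _ _ wv bv def' i' c' def i c le.
by split; [rewrite eC|rewrite -!(degree_count _ sE); left].
Qed.

Lemma no_triangle u v w : e u v -> e v w -> e w u -> False.
Proof.
move=> uv vw wu; case: e_tree => _ _ _ /(_ [:: u; v; w] isT)/negP[].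
have neq a b : e a b -> a != b by apply: contraTneq => ->; rewrite eI.
rewrite /ucycleb /= uv vw wu /= !inE !negb_or.
by rewrite neq // [u == w]eq_sym !neq.
Qed.

Lemma degree_gt0 v : 1 < n -> 0 < degree e v.
Proof.
move=> n1; have [w wv] : exists w : 'I_n, w != v.
  have : 0 < #|predC1 v| by rewrite cardC1 card_ord -subn1 subn_gt0.
  by case/card_gt0P => w; exists w.
rewrite /degree card_gt0; apply/set0Pn.
have /connectP[[|a q] /= pq wE] := eK v w; first by rewrite wE eqxx in wv.
by case/andP: pq => va _; exists a; rewrite in_set.
Qed.

Lemma degree_lt v : degree e v < n.
Proof.
rewrite -[X in _ < X]card_ord -cardsT; apply: proper_card; apply/properP.
by split; [exact: subsetT|exists v; rewrite !inE ?eI].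
Qed.

Let geqT : transitive geq. Proof. by move=> a b c /=; lia. Qed.
Let geqA : antisymmetric geq. Proof. by move=> a b /=; lia. Qed.
Let geqtot : total geq. Proof. by move=> a b /=; lia. Qed.

Lemma sorted_geq_filter m (t : seq nat) : sorted geq t ->
  t = [seq d <- t | m < d] ++ [seq d <- t | ~~ (m < d)].
Proof.
elim: t => //= d t IH pt; have {}IH := IH (path_sorted pt).
have /allP tmax := order_path_min geqT pt.
case: ltnP => dm /=; first by rewrite -IH.
have -> : [seq z <- t | m < z] = [::].
  rewrite -[RHS](filter_pred0 t); apply: eq_in_filter => z /tmax /=; lia.
rewrite /=; congr (_ :: _); apply/esym/all_filterP/allP => z /tmax /=; lia.
Qed.

(** Connectedness makes all degrees positive, so the entries up to 2 form a run of 2's followed by a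
    run of 1's. *)
Lemma degree_sequence_split : 1 < n -> exists p q : nat,
  degree_sequence e =
    sort geq [seq degree e v | v <- enum branch] ++ nseq p 2 ++ nseq q 1.
Proof.
move=> n1; set ds := degree_sequence e.
have dsS : sorted geq ds by apply: sort_sorted.
have [||p [q pqE]] := @sorted_geq_small [seq d <- ds | ~~ (2 < d)].
- exact: sorted_filter.
- rewrite all_filter; apply/allP => d /=; rewrite mem_sort => /mapP[v _ ->].
  by rewrite -leqNgt degree_gt0 //; apply/implyP.
exists p, q; rewrite -pqE {1}(sorted_geq_filter 2 dsS); congr (_ ++ _).
rewrite /ds /degree_sequence filter_sort // filter_map; congr (sort _ (map _ _)).
exact: filter_enum_ord.
Qed.

(** The two ends of an edge form a set closed under adjacency, hence by connectedness the whole
    vertex set. *)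
Lemma degree1_order2 : (forall v, degree e v = 1) -> n = 2.
Proof.
move=> deg1; pose a := Ordinal n_gt0.
have uniq_nbr x y z : e x y -> e x z -> y = z.
  move=> xy xz; have /card_le1_eqP : #|[set w | e x w]| <= 1.
    by rewrite -[#|_|]/(degree e x) deg1.
  by apply; rewrite inE.
have /card_gt0P[b] : 0 < #|[set w | e a w]| by rewrite -[#|_|]/(degree e a) deg1.
rewrite inE => ab.
have cl : closed e (mem [set a; b]).
  apply: intro_closed => [|x y xy]; first exact: sym_connect_sym.
  rewrite !inE => /orP[/eqP xa|/eqP xb].
    by rewrite (uniq_nbr a y b) ?eqxx ?orbT // -xa.
  by rewrite (uniq_nbr b y a) ?eqxx // -?xb // xb eC.
have le2 : n <= 2.
  rewrite -[X in X <= _]card_ord -cardsT; apply: leq_trans (_ : #|[set a; b]| <= 2).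
    apply: subset_leq_card; apply/subsetP => c _.
    rewrite -[_ \in _]/(c \in mem [set a; b]).
    by rewrite -(closed_connect cl (eK a c)) !inE eqxx.
  by rewrite cards2; case: (_ != _).
apply/eqP; rewrite eqn_leq le2 /=.
have neq : a != b by apply: contraTneq ab => <-; rewrite eI.
rewrite -[X in _ <= X]card_ord -cardsT.
by rewrite (leq_trans _ (subset_leq_card (subsetT [set a; b]))) // cards2 neq.
Qed.

Lemma edge_order_gt1 d : d \in edge_list e -> 1 < n.
Proof.
rewrite mem_edge_list => /andP[lt _]; apply: leq_ltn_trans (ltn_ord d.2).
exact: leq_ltn_trans lt.
Qed.

Lemma good_order_forms s : perm_eq s (edge_list e) -> 0 < size s ->
  good_order s -> form_i e \/ form_ii e \/ form_iii e.
Proof.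
move=> sE s0 sG.
have n1 : 1 < n.
  case: s s0 sE {sG} => // d s _ sE; apply: (@edge_order_gt1 d).
  by rewrite -(perm_mem sE) inE eqxx.
have [p [q dsE]] := degree_sequence_split n1.
have br v : v \in enum branch -> branch v by rewrite mem_enum.
have brU : uniq (enum branch) by apply: enum_uniq.
have pair v w : v \in enum branch -> w \in enum branch -> v != w ->
    e v w /\ (degree e v = 3 \/ degree e w = 3).
  by move=> /br bv /br bw vw; apply: branch_pair vw bv bw; eauto.
case bE : (enum branch) dsE br brU pair => [|v [|w [|z r]]] /= dsE br brU pair.
- case: p dsE => [|p] /= dsE; last first.
    (* For a path, the first of the [p.+1] entries equal to 2 plays the role of [m]. *)
    right; left; exists 2, p, q; split=> //=.
    have : 2 \in degree_sequence e by rewrite dsE inE eqxx.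
    by rewrite mem_sort => /mapP[v _ ->]; apply: degree_lt.
  left; have n2 : n = 2.
    apply: degree1_order2 => v.
    have : degree e v \in degree_sequence e by rewrite mem_sort map_f ?mem_enum.
    by rewrite dsE => /nseqP[].
  have : size (degree_sequence e) = n by rewrite size_sort size_map size_enum_ord.
  by rewrite /form_i dsE size_nseq n2 => ->.
- have bv : 2 < degree e v by apply: br; rewrite inE.
  right; left; exists (degree e v), p, q; split; first by rewrite (ltnW bv) degree_lt.
  by rewrite dsE.
- have vw : v != w by move: brU; rewrite inE => /andP[].
  have bv : 2 < degree e v by apply: br; rewrite inE eqxx.
  have bw : 2 < degree e w by apply: br; rewrite !inE eqxx orbT.
  have [||| vwe d3] := pair v w; rewrite ?inE ?eqxx ?orbT //.
  right; right; case: d3 => d3.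
    exists (degree e w), p, q.
    split; [by rewrite bw degree_lt| |by exists w, v; rewrite eC].
    rewrite dsE -[RHS]/([:: degree e w; 3] ++ _); congr (_ ++ _).
    rewrite d3 -[RHS](sorted_sort (leT := geq) geqT
                                  (s := [:: degree e w; 3])) /= ?bw //.
    by apply/perm_sortP => //; apply/permP => P /=; lia.
  exists (degree e v), p, q.
  split; [by rewrite bv degree_lt| |by exists v, w].
  rewrite dsE -[RHS]/([:: degree e v; 3] ++ _); congr (_ ++ _).
  by rewrite d3 sorted_sort //= bv.
- have [] : [/\ e v w, e w z & e z v].
    move: brU; rewrite /= !inE !negb_or => /and3P[/and3P[vw vz _] /andP[wz _] _].
    split.
    + by have [|||->] := pair v w; rewrite ?inE ?eqxx ?orbT.
    + by have [|||->] := pair w z; rewrite ?inE ?eqxx ?orbT.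
    + by have [|||->] := pair z v; rewrite ?inE ?eqxx ?orbT // eq_sym.
  by move=> vw wz zv; case: (no_triangle vw wz zv).
Qed.

Lemma card_branch : #|branch| = count (fun m : nat => 2 < m) (degree_sequence e).
Proof.
have /permP -> : perm_eq (degree_sequence e) [seq degree e v | v <- enum 'I_n].
  by rewrite perm_sort.
by rewrite count_map -size_filter filter_enum_ord -cardE.
Qed.

(** A common description of the three forms; [v = w] covers the case of at most one branch
    vertex. *)
Lemma forms_branch : form_i e \/ form_ii e \/ form_iii e ->
  exists v w, (forall p, p != v -> p != w -> degree e p <= 2) /\
              (w != v -> e v w /\ degree e w <= 3).
Proof.
have small (p q : nat) : count (fun m : nat => 2 < m) (nseq p 2 ++ nseq q 1) = 0.
  by rewrite count_cat !count_nseq.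
have one : #|branch| <= 1 -> exists v w,
    (forall p, p != v -> p != w -> degree e p <= 2) /\
    (w != v -> e v w /\ degree e w <= 3).
  move=> /card_le1_eqP br1.
  have [[v bv]|nb] := pselect (exists v, branch v).
    exists v, v; rewrite eqxx; split=> // p pv _; rewrite leqNgt.
    by apply: contra pv => bp; rewrite (br1 p v).
  exists (Ordinal n_gt0), (Ordinal n_gt0); rewrite eqxx; split=> // p _ _.
  by rewrite leqNgt; apply/negP => bp; case: nb; exists p.
case=> [ds|[[m [p [q [_ ds]]]]|[m [p [q [/andP[m3 _] ds [u [v [du dv uv]]]]]]]]].
- by apply: one; rewrite card_branch ds.
- by apply: one; rewrite card_branch ds /= small addn0 leq_b1.
exists u, v; split=> [a au av|_]; last by rewrite uv dv.
rewrite leqNgt; apply/negP => ba.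
have U : uniq [:: a; u; v].
  rewrite /= !inE negb_or au av /= andbT.
  by apply: contraTneq uv => ->; rewrite eI.
have := uniq_leq_size (s2 := enum branch) U.
rewrite -cardE card_branch ds /= small m3 /= => /(_ _)/negP[]// z.
by rewrite mem_enum !inE => /or3P[] /eqP -> //; rewrite ?du ?dv.
Qed.

(** Sorting by [rank] puts the edges at [v] at the end, and {v, w} last if [v] and [w] differ. The
    condition at [v] is then clear. At [w], which has at most three edges, a third edge can only be
    {v, w}, and at any other vertex there is no third edge. *)
Lemma branch_good_order v w :
    (forall p, p != v -> p != w -> degree e p <= 2) ->
    (w != v -> e v w /\ degree e w <= 3) ->
  exists s, perm_eq s (edge_list e) /\ good_order s.
Proof.
move=> small wv.
pose rank d := incident v d + (incident v d && incident w d).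
pose le d d' := rank d <= rank d'.
have le_trans : transitive le by move=> a b c; apply: leq_trans.
pose s := sort le (edge_list e); exists s.
have sE : perm_eq s (edge_list e) by rewrite perm_sort.
split=> // s1 d s2 sdef d' p d'd pd cnt.
have : sorted le s by apply: sort_sorted => a b; apply: leq_total.
rewrite sorted_pairwise // sdef pairwise_cat /= => /and4P[/allrelP s12 _ /allP ds2 _].
have led z : z \in d :: s2 -> le d z.
  by rewrite inE => /predU1P[->|/ds2 //]; apply: leqnn.
have le1 z : z \in s1 -> le z d by move=> zs; apply: s12; rewrite ?inE ?eqxx.
have rank2 z : 2 <= rank z -> incident w z.
  by rewrite /rank; case: (incident v z) (incident w z) => [] [].
have cntp : 3 + count (incident p) s2 <= degree e p.
  by rewrite (degree_count _ sE) sdef count_cat /= pd; lia.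
have [pv|pv] := eqVneq p v.
  have : rank d <= rank d' by apply: led.
  by rewrite /rank -pv pd; case: (incident p d').
have [pw|pw] := eqVneq p w; last by have := small p pv pw; lia.
rewrite pw in pv pd cntp cnt *; have [vw w3] := wv pv.
have [c [cE vc wc]] := edge_in_list vw.
have rc : rank c = 2 by rewrite /rank vc wc.
have rd : 2 <= rank d.
  move: cE; rewrite -(perm_mem sE) sdef mem_cat inE => /or3P[cs|/eqP <-|cs].
  - by rewrite -rc; apply: le1.
  - by rewrite rc.
  - have : 0 < count (incident w) s2 by rewrite -has_count; apply/hasP; exists c.
    lia.
by apply: rank2; apply: leq_trans rd _; apply: led.
Qed.

Lemma forms_good_order : form_i e \/ form_ii e \/ form_iii e ->
  exists s, [/\ perm_eq s (edge_list e), 0 < size s & good_order s].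
Proof.
move=> H; have [v [w [small wv]]] := forms_branch H.
have [s [sE sG]] := branch_good_order small wv; exists s; split=> //.
have [m m0 /mapP[u _ mE]] : exists2 m, 0 < m & m \in [seq degree e v | v <- enum 'I_n].
  have ms m : m \in degree_sequence e -> m \in [seq degree e v | v <- enum 'I_n].
    by rewrite mem_sort.
  case: H => [ds|[[m [p [q [/andP[m2 _] ds]]]]|[m [p [q [/andP[m3 _] ds _]]]]]].
  - by exists 1 => //; apply: ms; rewrite ds inE eqxx.
  - by exists m; [apply: ltnW|apply: ms; rewrite ds inE eqxx].
  - by exists m; [apply: leq_ltn_trans m3|apply: ms; rewrite ds inE eqxx].
move: m0; rewrite mE (degree_count _ sE).
by case: (s) => //.
Qed.

End TreeDegrees.

Theorem theorem1p1 (k : fieldType) (n : nat) (e : rel 'I_n)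
    (e_tree : is_tree e) :
  (edge_binomials_form_d_sequence k e <->
     form_i e \/ form_ii e \/ form_iii e) /\
  (form_i e \/ form_ii e \/ form_iii e ->
     linear_type (binomial_edge_ideal k e)).
Proof.
have sub s : perm_eq s (edge_list e) -> uniq s /\ {subset s <= edge_list e}.
  move=> sE; rewrite (perm_uniq sE) uniq_edge_list; split=> // d.
  by rewrite (perm_mem sE).
have dseq : form_i e \/ form_ii e \/ form_iii e -> exists s,
    perm_eq s (edge_list e) /\ d_sequence [seq edge_poly k d | d <- s].
  move=> /(forms_good_order e_tree)[s [sE s0 sG]]; exists s; split=> //.
  by have [sU sub_s] := sub s sE; exact: (good_order_d_sequence k e_tree sU sub_s s0 sG).
split; first split.
(* The ordering of the binomials is lifted to an ordering of the edges through the positions [is']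
   in the list. *)
- move=> [a [/(perm_iotaP 0%R)[is' isP ->] ad]].
  have size_edges : size (edge_binomials k e) = size (edge_list e).
    exact: size_map.
  have [d0 d0E] : exists d0, d0 \in edge_list e.
    case: ad => s0 _ _; move: s0; rewrite size_map (perm_size isP) size_iota.
    by rewrite size_edges; case: (edge_list e) => // d0 *;
      exists d0; apply: mem_head.
  pose s := [seq nth d0 (edge_list e) i | i <- is'].
  have sE : perm_eq s (edge_list e).
    by apply/(perm_iotaP d0); exists is'; rewrite // -size_edges.
  have aE : [seq nth 0%R (edge_binomials k e) i | i <- is']
             = [seq edge_poly k d | d <- s].
    rewrite -map_comp; apply/eq_in_map => i.
    rewrite (perm_mem isP) mem_iota size_edges => /andP[_ lti] /=.
    exact: nth_map.
  rewrite aE in ad; have [sU sub_s] := sub s sE.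
  apply: (good_order_forms e_tree sE); last exact: (good_order_necessary e_tree sU sub_s ad).
  by case: ad; rewrite size_map.
- move=> /dseq[s [sE sd]]; exists [seq edge_poly k d | d <- s]; split=> //.
  exact: perm_map sE.
- move=> /dseq[s [sE sd]]; apply: d_sequence_linear_type sd => x.
  by apply/idP/idP; apply: gen_ideal_sub => y ys; apply: mem_gen_ideal;
    move: ys; rewrite (perm_mem (perm_map (@edge_poly k n) sE)).
Qed.
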